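(* For $m\ge1$ let $\mathcal F_m\in\pi_0$ be the element $$\mathcal F_m=\tfrac12h_m\big(T+\mu_1[-1],\dots,T+\mu_{n-1}[-1],T-\mu_n[-1],\dots,T-\mu_1[-1]\big)+\tfrac12h_m\big(T+\mu_1[-1],\dots,T+\mu_n[-1],T-\mu_{n-1}[-1],\dots,T-\mu_1[-1]\big)$$ and let $\mathcal E'_n=\big(\mu_1[-1]-T\big)\cdots\big(\mu_n[-1]-T\big)\in\pi_0$ (both operator expressions being applied to $1\in\pi_0$). Then the elements $\mathcal F_2,\mathcal F_4,\dots,\mathcal F_{2n-2},\mathcal E'_n$ form a complete set of generators of the classical $\mathcal W$-algebra $\mathcal W(\mathfrak o_{2n})$.
   Context: $\mathfrak o_{2n}$ is assumed simple. $\pi_0=\mathbb C[\mu_i[r]\mid i=1,\dots,n,\ r<0]$, and $T:\pi_0\to\pi_0$ is the derivation with $T\mu_i[r]=-r\mu_i[r-1]$, so $T\,1=0$. In the expressions above $\mu_i[-1]$ acts on $\pi_0$ by multiplication. $h_m(x_1,\dots,x_p)=\sum_{i_1\le\dots\le i_m}x_{i_1}\cdots x_{i_m}$ for ordered noncommuting variables. The classical $\mathcal W$-algebra is $\mathcal W(\mathfrak o_{2n})=\{P\in\pi_0\mid V_iP=0,\ i=1,\dots,n\}$, where the screening operators are the derivations $$V_i=\sum_{r\ge0}V_{i[r]}\Big(\frac{\partial}{\partial\mu_i[-r-1]}-\frac{\partial}{\partial\mu_{i+1}[-r-1]}\Big)\ (1\le i\le n-1),\qquad V_n=\sum_{r\ge0}V_{n[r]}\Big(\frac{\partial}{\partial\mu_{n-1}[-r-1]}+\frac{\partial}{\partial\mu_n[-r-1]}\Big),$$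 $$\sum_{r\ge0}V_{i[r]}z^r=\exp\sum_{m\ge1}\frac{\mu_i[-m]-\mu_{i+1}[-m]}{m}z^m,\qquad \sum_{r\ge0}V_{n[r]}z^r=\exp\sum_{m\ge1}\frac{\mu_{n-1}[-m]+\mu_n[-m]}{m}z^m.$$ It is a $T$-invariant subalgebra. Elements $B_1,\dots,B_n\in\mathcal W(\mathfrak o_{2n})$ form a complete set of generators if the elements $T^rB_i$, $i=1,\dots,n$, $r\ge0$, are algebraically independent and generate $\mathcal W(\mathfrak o_{2n})$. *)

(* Defs.v *)
From HB Require Import structures.
From mathcomp Require Import all_boot all_order all_algebra.
From mathcomp Require Import finmap.
From mathcomp.multinomials Require Import monalg.
From mathcomp Require Import complex reals.

Set Implicit Arguments.
Unset Strict Implicit.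
Unset Printing Implicit Defensive.

Import GRing.Theory.
Local Open Scope ring_scope.

Notation polyalg C X := {malg C[{cmonom X}]}.

Lemma leibniz_sum (A : nzRingType) (f : A -> A) I J (s : seq I) (t : seq J)
    (u : I -> A) (v : J -> A) :
  {morph f : x y / x + y} -> f 0 = 0 ->
  (forall i j, f (u i * v j) = f (u i) * v j + u i * f (v j)) ->
  f ((\sum_(i <- s) u i) * (\sum_(j <- t) v j)) =
  f (\sum_(i <- s) u i) * (\sum_(j <- t) v j) +
  (\sum_(i <- s) u i) * f (\sum_(j <- t) v j).
Proof.
move=> fD f0 fM; elim/big_rec: _ => [|i x _ IHx].
  by rewrite mul0r f0 !mul0r addr0.
rewrite mulrDl !fD IHx !mulrDl addrACA; congr (_ + _).
elim/big_rec: _ => [|j y _ IHy]; first by rewrite mulr0 f0 !mulr0 addr0.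
by rewrite mulrDr !fD IHy fM !mulrDr addrACA.
Qed.

Section PolynomialAlgebra.

Variables (C : fieldType) (X : choiceType).

(* The term c m.  Locked, since unification unfolds distinct monomials at
   a prohibitive cost. *)
Fact pmono_key : unit. Proof. exact: tt. Qed.
Definition pmono : C -> {cmonom X} -> polyalg C X :=
  locked_with pmono_key (fun c m => << c *g m >>).

Lemma pmonoE (c : C) (m : {cmonom X}) : pmono c m = << c *g m >>.
Proof. by rewrite /pmono unlock. Qed.

Definition pvar (x : X) : polyalg C X := pmono 1 (ucm x).

Definition pderiv (x : X) (P : polyalg C X) : polyalg C X :=
  \sum_(m <- msupp P) pmono (P@_m *+ m x) (divcm m (ucm x)).

(* The C-algebra morphism [polyalg C X -> A] mapping each variable x to b x. *)
Definition peval (A : comAlgType C) (b : X -> A) (P : polyalg C X) : A :=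
  \sum_(m <- msupp P) P@_m *: \prod_(x <- finsupp m) b x ^+ m x.

Lemma pmono0 (m : {cmonom X}) : pmono 0 m = 0.
Proof. by rewrite pmonoE monalgU0. Qed.

Lemma pmonoD (m : {cmonom X}) : {morph pmono^~ m : c d / c + d}.
Proof. by move=> c d; rewrite !pmonoE monalgUD. Qed.

Lemma pmonoM (c d : C) (m k : {cmonom X}) :
  pmono c m * pmono d k = pmono (c * d) (mmul m k).
Proof. by rewrite !pmonoE malgM_def; exact: fgmulUU. Qed.

Lemma pderivEw (x : X) (P : polyalg C X) (D : {fset {cmonom X}}) :
  (msupp P `<=` D)%fset ->
  pderiv x P = \sum_(m <- D) pmono (P@_m *+ m x) (divcm m (ucm x)).
Proof.
move=> sPD; rewrite /pderiv (big_fset_incl _ sPD) //= => m _ mP.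
by rewrite mcoeff_outdom // mul0rn pmono0.
Qed.

Lemma pderivD (x : X) : {morph @pderiv x : P Q / P + Q}.
Proof.
move=> P Q; pose D := (msupp P `|` msupp Q)%fset.
rewrite (@pderivEw x _ D) ?msuppD_le // (@pderivEw x P D) ?fsubsetUl //.
rewrite (@pderivEw x Q D) ?fsubsetUr // -big_split /=.
by apply: eq_bigr => m _; rewrite mcoeffD mulrnDl pmonoD.
Qed.

Lemma pderiv0 (x : X) : pderiv x 0 = 0.
Proof. by rewrite /pderiv msupp0 big_seq_fset0. Qed.

Lemma pderiv_mono (x : X) (c : C) (m : {cmonom X}) :
  pderiv x (pmono c m) = pmono (c *+ m x) (divcm m (ucm x)).
Proof.
rewrite (@pderivEw x _ [fset m]%fset); last by rewrite pmonoE msuppU_le.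
by rewrite big_seq_fset1 [in (pmono c m)@__]pmonoE mcoeffUU.
Qed.

Lemma pderiv_var (x y : X) : pderiv x (pvar y) = (x == y)%:R.
Proof.
rewrite /pvar pderiv_mono ucmE; case: eqVneq => [->|_]; last by rewrite pmono0.
have -> : divcm (ucm x) (ucm x) = mone :> {cmonom X}.
  by apply/eqP/cmP => z; rewrite divcmE subnn cm1.
rewrite pmonoE; exact: mpolyC1E.
Qed.

Lemma pderivM (x : X) (P Q : polyalg C X) :
  pderiv x (P * Q) = pderiv x P * Q + P * pderiv x Q.
Proof.
have shift (a b : {cmonom X}) : (0 < a x)%N ->
    divcm (mmul a b) (ucm x) = mmul (divcm a (ucm x)) b.
  move=> a0; apply/eqP/cmP => z; rewrite divcmE !cmM divcmE ucmE.
  by case: eqVneq => [<-|_] /=; rewrite ?subn0 // addnBAC.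
have MU (c d : C) (m k : {cmonom X}) :
    pderiv x (pmono c m * pmono d k) =
    pderiv x (pmono c m) * pmono d k + pmono c m * pderiv x (pmono d k).
  rewrite pmonoM !pderiv_mono !pmonoM cmM mulrnDr pmonoD; congr (_ + _).
    case: (posnP (m x)) => [->|m0]; first by rewrite !mulr0n mul0r !pmono0.
    by rewrite shift // mulrnAl.
  case: (posnP (k x)) => [->|k0]; first by rewrite !mulr0n mulr0 !pmono0.
  by rewrite [mmul m k]mulmC shift // [mmul _ m]mulmC mulrnAr.
have PE (S : polyalg C X) : S = \sum_(m <- msupp S) pmono S@_m m.
  by under eq_bigr do rewrite pmonoE; exact: monalgE.
rewrite (PE P) (PE Q); apply: leibniz_sum (pderivD x) (pderiv0 x) _ => m k.
exact: MU.
Qed.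

End PolynomialAlgebra.

Section ClassicalWAlgebra.

Variables (R : realType) (n : nat).

Local Notation C := R[i].

(* The index (i, r) stands for the variable mu_{i+1}[-r-1] of the source:
   the index i is 0-based and r >= 0 encodes the negative integer -r-1. *)
Local Notation pi0 := (polyalg C ('I_n * nat)%type).

Definition mu (i : 'I_n) (r : nat) : pi0 := pvar C (i, r).

Definition dmu (i : 'I_n) (r : nat) : pi0 -> pi0 := pderiv (i, r).

(* A bound on the second indices of the variables occurring in P. By [dmu_ge]
   below, the sums over all r >= 0 defining derivations of pi0 may be
   truncated at [mu_bound P]. *)
Definition mu_bound (P : pi0) : nat :=
  \max_(m <- msupp P) \max_(x <- finsupp m) x.2.+1.

Lemma dmu_ge (i : 'I_n) (r : nat) (P : pi0) :
  (mu_bound P <= r)%N -> dmu i r P = 0.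
Proof.
move=> le_r; rewrite /dmu /pderiv big_seq big1 // => m mP.
suff /eqP -> : m (i, r) == 0%N by rewrite mulr0n pmono0.
rewrite cmE_eq0; apply: contraTN le_r => xm; rewrite -ltnNge.
apply: leq_trans (leq_bigmax_seq (F := fun x => x.2.+1) _ xm isT) _.
exact: (leq_bigmax_seq (F := fun k : {cmonom _} =>
  \max_(x <- finsupp k) x.2.+1) _ mP isT).
Qed.

Definition derT (P : pi0) : pi0 :=
  \sum_(i < n) \sum_(r < mu_bound P) (r.+1%:R * mu i r.+1) * dmu i r P.

Lemma derTEw (N : nat) (P : pi0) : (mu_bound P <= N)%N ->
  derT P = \sum_(i < n) \sum_(r < N) (r.+1%:R * mu i r.+1) * dmu i r P.
Proof.
move=> leN; apply: eq_bigr => i _.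
rewrite (big_ord_widen N (fun r => (r.+1%:R * mu i r.+1) * dmu i r P)) //.
rewrite big_mkcond; apply: eq_bigr => r _; case: ltnP => // ?.
by rewrite dmu_ge ?mulr0.
Qed.

Lemma derTD : {morph derT : P Q / P + Q}.
Proof.
move=> P Q; pose N := maxn (mu_bound (P + Q)) (maxn (mu_bound P) (mu_bound Q)).
rewrite !(@derTEw N) ?leq_max ?leqnn ?orbT // -big_split; apply: eq_bigr => i _.
by rewrite -big_split; apply: eq_bigr => r _; rewrite /dmu pderivD mulrDr.
Qed.

Lemma derTM (P Q : pi0) : derT (P * Q) = derT P * Q + P * derT Q.
Proof.
have scale_leib (A : comNzRingType) (a p q p' q' : A) :
  a * (p' * q + p * q') = a * p' * q + p * (a * q').
  by rewrite mulrDr !mulrA (mulrC p a).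
pose N := maxn (mu_bound (P * Q)) (maxn (mu_bound P) (mu_bound Q)).
rewrite !(@derTEw N) ?leq_max ?leqnn ?orbT // mulr_suml mulr_sumr -big_split.
apply: eq_bigr => i _; rewrite mulr_suml mulr_sumr -big_split.
apply: eq_bigr => r _; rewrite /dmu pderivM; exact: scale_leib.
Qed.

Lemma derT_mu (i : 'I_n) (r : nat) : derT (mu i r) = r.+1%:R * mu i r.+1.
Proof.
have delta (A : nzRingType) (c : 'I_n -> nat -> A) N : (r < N)%N ->
    \sum_(j < n) \sum_(s < N) c j s * ((j, nat_of_ord s) == (i, r))%:R = c i r.
  move=> rN; rewrite (bigD1 i) //= (bigD1 (Ordinal rN)) //= eqxx mulr1.
  rewrite big1 => [|s]; last first.
    by rewrite xpair_eqE eqxx -val_eqE /= => /negPf->; rewrite mulr0.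
  rewrite big1 ?addr0 // => j /negPf ne_j; rewrite big1 // => s _.
  by rewrite xpair_eqE ne_j mulr0.
rewrite (@derTEw (maxn (mu_bound (mu i r)) r.+1)) ?leq_maxl //.
rewrite -(delta _ (fun j s => s.+1%:R * mu j s.+1) (maxn (mu_bound (mu i r)) r.+1)).
  by apply: eq_bigr => j _; apply: eq_bigr => s _; rewrite /dmu pderiv_var.
by rewrite leq_max leqnn orbT.
Qed.

(* The coefficient of z^r in exp (\sum_(m >= 1) a m / m z^m).  The exponent has
   no constant term, so only its coefficients up to z^r, and only its powers
   up to the r-th, contribute. *)
Definition exp_coef (a : nat -> pi0) (r : nat) : pi0 :=
  \sum_(k < r.+1)
     (k`!%:R^-1 : C) *:
     ((\sum_(1 <= m < r.+1) ((m%:R^-1 : C) *: a m) *: 'X^m) ^+ k : {poly pi0})`_r.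

(* The screening operators attached to the roots eps_i - eps_j and
   eps_i + eps_j; for m >= 1, [mu i m.-1] is mu_i[-m] of the source. *)
Definition screening_sub (i j : 'I_n) (P : pi0) : pi0 :=
  \sum_(r < mu_bound P)
     exp_coef (fun m => mu i m.-1 - mu j m.-1) r * (dmu i r P - dmu j r P).

Definition screening_add (i j : 'I_n) (P : pi0) : pi0 :=
  \sum_(r < mu_bound P)
     exp_coef (fun m => mu i m.-1 + mu j m.-1) r * (dmu i r P + dmu j r P).

Definition classical_W (P : pi0) : Prop :=
  (forall i j : 'I_n, j = i.+1 :> nat -> screening_sub i j P = 0) /\
  (forall i j : 'I_n, i.+2 = n -> j.+1 = n -> screening_add i j P = 0).

Definition complete_generators (B : 'I_n -> pi0) : Prop :=
  let TB (x : 'I_n * nat) : pi0 := iter x.2 derT (B x.1) in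
  [/\ forall i, classical_W (B i),
      forall Q : polyalg C ('I_n * nat)%type, peval TB Q = 0 -> Q = 0
    & forall P : pi0, classical_W P <->
        exists Q : polyalg C ('I_n * nat)%type, P = peval TB Q].

(* The composite of the operators in the list s, the first one outermost. *)
Definition op_prod (s : seq (pi0 -> pi0)) (v : pi0) : pi0 :=
  foldr (fun f w => f w) v s.

Definition hsym (m : nat) (s : seq (pi0 -> pi0)) (v : pi0) : pi0 :=
  \sum_(t : m.-tuple 'I_(size s) | sorted leq [seq val i | i <- t])
     op_prod [seq nth id s (val i) | i <- t] v.

(* T + mu_i[-1], T - mu_i[-1] and mu_i[-1] - T. *)
Definition Tplus (i : 'I_n) (P : pi0) : pi0 := derT P + mu i 0 * P.
Definition Tminus (i : 'I_n) (P : pi0) : pi0 := derT P - mu i 0 * P.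
Definition mu_minus (i : 'I_n) (P : pi0) : pi0 := mu i 0 * P - derT P.

(* All the indices, and all but the last one, in increasing order. *)
Definition idx : seq 'I_n := enum 'I_n.
Definition idx' : seq 'I_n := [seq i : 'I_n <- idx | (i.+1 < n)%N].

Definition calF (m : nat) : pi0 :=
  (2%:R^-1 : C) *: hsym m (map Tplus idx' ++ map Tminus (rev idx)) 1 +
  (2%:R^-1 : C) *: hsym m (map Tplus idx ++ map Tminus (rev idx')) 1.

Definition calE' : pi0 := op_prod (map mu_minus idx) 1.

End ClassicalWAlgebra.

(* Main.v *)
Require Import Defs.
From mathcomp Require Import all_boot all_order all_algebra.
From mathcomp Require Import finmap.
From mathcomp.multinomials Require Import monalg.
From mathcomp Require Import complex reals.
From mathcomp Require Import zify ring.

(** Geometrically, pi_0 is the algebra of functions on the space of Miura opers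
    of type D_n, i.e. of connections d - p - u with u in the Cartan subalgebra and
    p the principal nilpotent element, and that space is the product of the space
    of opers with the unipotent group of the Borel subalgebra.  The screening
    operators are the simple root vectors acting on the second factor, so that
    the W-algebra consists of the functions on opers.  The proof turns this
    picture into explicit coordinates on pi_0.

    The level of a variable mu_i[-r-1] is r; up to the factor r! it is the r-th
    jet of mu_i[-1], i.e. its r-th derivative under T.

    The generators lie in the W-algebra.  A screening operator V of root alpha
    satisfies V T = (T + alpha) V, where alpha stands for its value on the
    mu_i[-1] (screening_root_operator).  In the generating series of the F_m, the
    product of the factors (1 - z x)^-1, the two operators x moved by V are
    neighbours and their contributions cancel (screened_pair); at the fork of the
    Dynkin diagram this only happens for the sum of the two terms of F_m
    (screened_triple).

    The generators are led by linear forms.  Modulo variables of lower level,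
    F_{2k} is a linear form in the jets of level 2k - 1 whose coefficients are
    differences of binomial coefficients, and E'_n is, up to sign, the jet of level
    n - 1 of mu_n[-1] (half_paths_leads, neg_path_leads).

    The nilpotent Lie algebra annihilates the W-algebra.  The Lie algebra so_2n is
    the exterior square of its vector representation; every pair of weight
    vectors of positive total weight acts on pi_0 by a derivation determined by
    its commutator with T.  The bracket with a screening operator is again such a
    derivation (pair_der_bracket), and since the simple root vectors generate,
    all of them annihilate the W-algebra (pair_der_eq0).

    The two structures are dual.  A root vector of height h acts by zero on jets of
    level less than h - 1, and by a constant on those of level h - 1, up to sign
    the Cartan component of its image under the h-th power of p.  Along suitable chains
    of p these constants form a direction c_k that is the same at all levels below
    the exponent e_k of k, and the matrix of the pairings of the leading form of the
    j-th generator with c_k is triangular with nonzero diagonal (pairing_lt,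
    pairing_diag), because it is computed by iterated differences of binomial
    coefficients.

    Consequently the leading forms are linearly independent, so the jets of the
    generators, together with the leading forms at the levels below the
    exponents, are obtained from the variables by a triangular change of
    coordinates (triangular_inj, triangular_surj).  This gives algebraic
    independence.  In these coordinates, the derivations along the chains
    annihilate the jets of the generators and act triangularly on the other
    coordinates; a polynomial annihilated by them therefore does not involve the
    latter, and is a polynomial in the jets of the generators
    (generators_generate). *)

Set Implicit Arguments.
Unset Strict Implicit.
Unset Printing Implicit Defensive.

Import GRing.Theory Num.Theory.
Local Open Scope ring_scope.

(** * Derivations of commutative algebras *)

Section Derivations.

Variables (K : fieldType) (A : comAlgType K).

Definition derivation (D : A -> A) : Prop :=
  [/\ forall P Q, D (P + Q) = D P + D Q,
      forall P Q, D (P * Q) = D P * Q + P * D Q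
    & forall c P, D (c *: P) = c *: D P].

Section OneDerivation.

Variables (D : A -> A) (dD : derivation D).

Lemma drvD P Q : D (P + Q) = D P + D Q.
Proof. by case: dD. Qed.

Lemma drvM P Q : D (P * Q) = D P * Q + P * D Q.
Proof. by case: dD. Qed.

Lemma drvZ c P : D (c *: P) = c *: D P.
Proof. by case: dD. Qed.

Lemma drv0 : D 0 = 0.
Proof. by have := drvZ 0 0; rewrite !scale0r. Qed.

Lemma drvN P : D (- P) = - D P.
Proof. by rewrite -scaleN1r drvZ scaleN1r. Qed.

Lemma drvB P Q : D (P - Q) = D P - D Q.
Proof. by rewrite drvD drvN. Qed.

Lemma drv1 : D 1 = 0.
Proof.
by apply: (addrI (D 1)); have := drvM 1 1; rewrite !mulr1 mul1r addr0 => <-.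
Qed.

Lemma drv_alg c : D c%:A = 0.
Proof. by rewrite drvZ drv1 scaler0. Qed.

Lemma drv_sum I (s : seq I) (p : pred I) (F : I -> A) :
  D (\sum_(i <- s | p i) F i) = \sum_(i <- s | p i) D (F i).
Proof. exact: (big_morph D drvD drv0). Qed.

End OneDerivation.

Lemma derivation_ext D E : D =1 E -> derivation D -> derivation E.
Proof.
move=> eDE [DD DM DZ]; split=> *; rewrite -!eDE; [exact: DD|exact: DM|exact: DZ].
Qed.

Lemma derivation0 : derivation (fun=> 0).
Proof. by split=> *; rewrite ?addr0 ?mul0r ?mulr0 ?scaler0 ?addr0. Qed.

Lemma derivation_add D E :
  derivation D -> derivation E -> derivation (fun P => D P + E P).
Proof.
move=> dD derE; split=> [P Q|P Q|c P].
- by rewrite !(drvD dD, drvD derE) addrACA.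
- rewrite !(drvM dD, drvM derE); ring.
- by rewrite (drvZ dD) (drvZ derE) scalerDr.
Qed.

Lemma derivation_mul a D : derivation D -> derivation (fun P => a * D P).
Proof.
move=> dD; split=> [P Q|P Q|c P].
- by rewrite (drvD dD) mulrDr.
- rewrite (drvM dD); ring.
- by rewrite (drvZ dD) scalerAr.
Qed.

Lemma derivation_opp D : derivation D -> derivation (fun P => - D P).
Proof.
move=> dD; apply: derivation_ext (derivation_mul (-1) dD) => P.
by rewrite mulN1r.
Qed.

Lemma derivation_sub D E :
  derivation D -> derivation E -> derivation (fun P => D P - E P).
Proof. by move=> dD derE; exact/derivation_add/derivation_opp. Qed.

Lemma derivation_scale c D : derivation D -> derivation (fun P => c *: D P).
Proof.
move=> dD; apply: derivation_ext (derivation_mul c%:A dD) => P.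
by rewrite mulr_algl.
Qed.

Lemma derivation_comm D E :
  derivation D -> derivation E -> derivation (fun P => D (E P) - E (D P)).
Proof.
move=> dD derE; split=> [P Q|P Q|c P].
- rewrite !(drvD dD, drvD derE); ring.
- rewrite !(drvM dD, drvM derE, drvD dD, drvD derE); ring.
- by rewrite !(drvZ dD, drvZ derE) scalerBr.
Qed.

Lemma derivation_sum I (s : seq I) (p : pred I) (F : I -> A -> A) :
  (forall i, derivation (F i)) ->
  derivation (fun P => \sum_(i <- s | p i) F i P).
Proof.
move=> derF; elim: s => [|i s IHs].
  by apply: derivation_ext derivation0 => P; rewrite big_nil.
case pi: (p i); last first.
  by apply: derivation_ext IHs => P; rewrite big_cons pi.
apply: derivation_ext (derivation_add (derF i) IHs) => P.
by rewrite big_cons pi.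
Qed.

End Derivations.

(** * Polynomial algebras: evaluation, partial derivatives, chain rule *)

Section Polynomials.

Variables (K : fieldType) (X : choiceType).
Hypothesis charK : forall m : nat, m.+1%:R != 0 :> K.

Local Notation PA := (polyalg K X).

Lemma divcm_mulU (k m : {cmonom X}) (x : X) : (0 < k x)%N ->
  (divcm k (ucm x) == m) = (k == mmul m (ucm x)).
Proof.
move=> kx; apply/eqP/eqP => [<-|->]; apply/eqP/cmP => y.
  by rewrite cmM divcmE subnK // ucmE; case: eqVneq => [<-|].
by rewrite divcmE cmM addnK.
Qed.

Lemma pmono_coef (c : K) (k m : {cmonom X}) : (pmono c k)@_m = c *+ (k == m).
Proof. by rewrite pmonoE mcoeffU. Qed.

Lemma pmono_sum (P : PA) : P = \sum_(m <- msupp P) pmono P@_m m.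
Proof. by under eq_bigr do rewrite pmonoE; exact: monalgE. Qed.

Lemma mcoeff_pderiv (x : X) (P : PA) (m : {cmonom X}) :
  (pderiv x P)@_m = P@_(mmul m (ucm x)) *+ (m x).+1.
Proof.
rewrite /pderiv raddf_sum {3}(pmono_sum P) raddf_sum -sumrMnl.
apply: eq_bigr => k _; rewrite /= !pmono_coef.
case: (posnP (k x)) => [k0|kpos]; last first.
  rewrite divcm_mulU //; case: eqVneq => [->|_]; last by rewrite !mulr0n mul0rn.
  by rewrite cmM ucmE eqxx !mulr1n addn1.
rewrite k0 mulr0n mul0rn; case: eqVneq => [ek|_]; last by rewrite mulr0n mul0rn.
by move: k0; rewrite ek cmM ucmE eqxx addn1.
Qed.

Lemma pderiv_neq0 (P : PA) (m : {cmonom X}) (x : X) :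
  m \in msupp P -> (0 < m x)%N -> pderiv x P != 0.
Proof.
move=> mP mx; apply: contraTneq mP => dP0.
rewrite -mcoeff_neq0 negbK.
have := mcoeff_pderiv x P (divcm m (ucm x)); rewrite dP0 mcoeff0.
have /eqP <- : m == mmul (divcm m (ucm x)) (ucm x) by rewrite -divcm_mulU.
by move/esym/eqP; rewrite -mulr_natr mulf_eq0 (negPf (charK _)) orbF.
Qed.

Lemma pderiv_eq0_const (P : PA) : (forall x, pderiv x P = 0) -> P = (P@_mone)%:A.
Proof.
move=> dP; apply/malgP => m; rewrite mcoeffZ mcoeff1.
case: (eqVneq m mone) => [->|m1]; first by rewrite mulr1.
rewrite mulr0; apply/eqP; apply: contraNT m1; rewrite mcoeff_neq0 => mP.
apply/cmP => x; rewrite onecmE; apply/eqP; rewrite -leqn0 leqNgt.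
by apply/negP => mx; have /eqP := pderiv_neq0 mP mx; rewrite dP.
Qed.

Lemma derivation_pderiv (x : X) : derivation (@pderiv K X x).
Proof.
split=> [P Q|P Q|c P]; [exact: pderivD|exact: pderivM|].
rewrite -!mul_malgC pderivM -pmonoE pderiv_mono.
by rewrite [X in _ *+ X]cm1 mulr0n pmono0 mul0r add0r.
Qed.

Lemma pderiv_lt_size (x : X) (P : PA) (d : nat) :
  (forall m, m \in msupp P -> (mdeg m < d.+1)%N) ->
  (forall m, m \in msupp (pderiv x P) -> (mdeg m < d)%N).
Proof.
move=> degP m; rewrite -mcoeff_neq0 mcoeff_pderiv => nz.
have : mmul m (ucm x) \in msupp P.
  by rewrite -mcoeff_neq0; apply: contraNneq nz => ->; rewrite mul0rn.
by move/degP; rewrite mdegM mdegU addn1.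
Qed.

Section Evaluation.

Variables (A : comAlgType K).

Definition monom_eval (b : X -> A) (m : {cmonom X}) : A :=
  \prod_(x <- finsupp m) b x ^+ m x.

Lemma monom_evalEw b (m : {cmonom X}) (D : {fset X}) :
  (finsupp m `<=` D)%fset -> monom_eval b m = \prod_(x <- D) b x ^+ m x.
Proof.
move=> sD; rewrite /monom_eval (big_fset_incl _ sD) //= => x _ xm.
by move: xm; rewrite -cmE_eq0 => /eqP->.
Qed.

Lemma monom_evalM b (m k : {cmonom X}) :
  monom_eval b (mmul m k) = monom_eval b m * monom_eval b k.
Proof.
rewrite (@monom_evalEw b (mmul m k) (finsupp m `|` finsupp k)%fset) ?mdomD //.
rewrite (@monom_evalEw b m (finsupp m `|` finsupp k)%fset) ?fsubsetUl //.
rewrite (@monom_evalEw b k (finsupp m `|` finsupp k)%fset) ?fsubsetUr //.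
by rewrite -big_split; apply: eq_bigr => x _; rewrite cmM exprD.
Qed.

Lemma pevalEw b (P : PA) (D : {fset {cmonom X}}) : (msupp P `<=` D)%fset ->
  peval b P = \sum_(m <- D) P@_m *: monom_eval b m.
Proof.
move=> sD; rewrite /peval (big_fset_incl _ sD) //= => m _ mP.
by rewrite mcoeff_outdom // scale0r.
Qed.

Lemma pevalD (b : X -> A) : {morph peval b : P Q / P + Q}.
Proof.
move=> P Q; pose D := (msupp P `|` msupp Q)%fset.
rewrite (@pevalEw b _ D) ?msuppD_le // (@pevalEw b P D) ?fsubsetUl //.
rewrite (@pevalEw b Q D) ?fsubsetUr // -big_split /=.
by apply: eq_bigr => m _; rewrite mcoeffD scalerDl.
Qed.

Lemma peval0 (b : X -> A) : @peval K X A b 0 = 0.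
Proof. by rewrite /peval msupp0 big_seq_fset0. Qed.

Lemma peval_mono (b : X -> A) (c : K) (m : {cmonom X}) :
  peval b (pmono c m) = c *: monom_eval b m.
Proof.
rewrite (@pevalEw b _ [fset m]%fset); last by rewrite pmonoE msuppU_le.
by rewrite big_seq_fset1 pmono_coef eqxx mulr1n.
Qed.

Lemma pevalM (b : X -> A) : {morph @peval K X A b : P Q / P * Q}.
Proof.
move=> P Q; rewrite {1}(pmono_sum P) {1}(pmono_sum Q) mulr_suml.
rewrite (big_morph _ (@pevalD b) (@peval0 b)) {2}/peval mulr_suml.
apply: eq_bigr => m _; rewrite mulr_sumr.
rewrite (big_morph _ (@pevalD b) (@peval0 b)) {2}/peval mulr_sumr.
apply: eq_bigr => k _; rewrite pmonoM peval_mono monom_evalM.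
by rewrite -scalerAl -scalerAr scalerA.
Qed.

Lemma pevalZ (b : X -> A) c (P : PA) : peval b (c *: P) = c *: peval b P.
Proof.
rewrite (@pevalEw b _ (msupp P)) ?msuppZ_le // /peval scaler_sumr.
by apply: eq_bigr => m _; rewrite mcoeffZ scalerA.
Qed.

Lemma peval1 (b : X -> A) : @peval K X A b 1 = 1.
Proof.
have -> : 1 = pmono 1 mone :> PA by rewrite pmonoE; exact/esym/mpolyC1E.
by rewrite peval_mono scale1r /monom_eval mdom1 big_seq_fset0.
Qed.

Lemma peval_alg (b : X -> A) c : @peval K X A b c%:A = c%:A.
Proof. by rewrite pevalZ peval1. Qed.

Lemma peval_var (b : X -> A) (x : X) : peval b (pvar K x) = b x.
Proof.
rewrite /pvar peval_mono scale1r /monom_eval mdomU big_seq_fset1.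
by rewrite ucmE eqxx expr1.
Qed.

(** In characteristic zero, a variable occurs in P as soon as the corresponding
    partial derivative does not vanish, and conversely. *)
Lemma peval_closed (S : A -> Prop) (b : X -> A) (P : PA) :
  (forall c, S c%:A) -> (forall Q R, S Q -> S R -> S (Q + R)) ->
  (forall Q R, S Q -> S R -> S (Q * R)) ->
  (forall x, pderiv x P != 0 -> S (b x)) -> S (peval b P).
Proof.
move=> SC SD SM Sb.
have S0 : S 0 by rewrite -(scale0r 1).
have S1 : S 1 by rewrite -(scale1r 1).
rewrite /peval big_seq; apply: (big_ind S) => // m mP.
rewrite -mulr_algl; apply: (SM) => //.
rewrite big_seq; apply: (big_ind S) => // x xm.
have Sbx : S (b x) by apply/Sb/(pderiv_neq0 mP); rewrite lt0n cmE_neq0.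
by elim: (m x) => [|d IHd]; rewrite ?expr0 // exprS; apply: (SM).
Qed.

Lemma eq_peval (b b' : X -> A) (P : PA) :
  (forall x, pderiv x P != 0 -> b x = b' x) -> peval b P = peval b' P.
Proof.
move=> ebb'; rewrite /peval big_seq [RHS]big_seq; apply: eq_bigr => m mP.
congr (_ *: _); rewrite big_seq [RHS]big_seq; apply: eq_bigr => x xm.
by rewrite ebb' //; apply: (pderiv_neq0 mP); rewrite lt0n cmE_neq0.
Qed.

End Evaluation.

Lemma peval_pvar (P : PA) : peval (@pvar K X) P = P.
Proof.
rewrite {2}(pmono_sum P) /peval; apply: eq_bigr => m _.
transitivity (P@_m *: pmono 1 m : PA); last first.
  by apply/malgP => k; rewrite mcoeffZ !pmono_coef mulrnAr mulr1.
congr (_ *: _); rewrite /pvar.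
pose xpow (x : X) d : {cmonom X} := iter d (mmul (ucm x)) mone.
have powE (x : X) d : pmono 1 (ucm x) ^+ d = pmono 1 (xpow x d) :> PA.
  elim: d => [|d IHd].
    by rewrite expr0 [RHS]pmonoE; exact/esym/mpolyC1E.
  by rewrite exprS IHd pmonoM mul1r.
have prodE (s : seq X) (F : X -> {cmonom X}) :
  \prod_(x <- s) pmono 1 (F x) = pmono 1 (\big[mmul/mone]_(x <- s) F x) :> PA.
  elim: s => [|x s IHs]; rewrite ?big_nil ?big_cons.
    by rewrite [RHS]pmonoE; exact/esym/mpolyC1E.
  by rewrite IHs pmonoM mul1r.
rewrite /monom_eval.
under eq_bigr do rewrite powE.
rewrite prodE; congr pmono; apply/eqP/cmP => y.
have expE (x : X) d : xpow x d y = ((x == y) * d)%N.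
  elim: d => [|d IHd]; first by rewrite muln0 cm1.
  by rewrite /xpow iterS cmM IHd ucmE mulnS.
rewrite (big_morph (fun k : {cmonom X} => k y) (fun k l => cmM y k l) (cm1 y)).
under eq_bigr do rewrite expE.
case: (boolP (y \in finsupp m)) => ym.
  rewrite (big_fsetD1 y) //= eqxx mul1n big_seq big1 ?addn0 // => x.
  by rewrite !inE => /andP[/negPf-> _].
move: (ym); rewrite -cmE_eq0 => /eqP->; rewrite big_seq big1 // => x xm.
by case: eqVneq xm ym => // -> ->.
Qed.

Lemma polyalg_ind (S : PA -> Prop) :
  (forall c, S c%:A) -> (forall Q R, S Q -> S R -> S (Q + R)) ->
  (forall Q R, S Q -> S R -> S (Q * R)) -> (forall x, S (pvar K x)) ->
  forall P, S P.
Proof.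
by move=> SC SD SM SX P; rewrite -(peval_pvar P); apply: peval_closed.
Qed.

End Polynomials.

(** * Polynomial algebras, axiomatically *)

(** The properties of a polynomial algebra A that the proof relies on: [var]
    are the variables, [dvar] the partial derivatives, [ev] the evaluation
    endomorphisms, [vf f] is the derivation mapping each variable x to f x and
    [deg] is a degree function.  Working with these alone keeps every argument
    independent of the representation of polynomials. *)
Record polynomial_model (K : fieldType) (X : eqType) (A : comAlgType K)
    (var : X -> A) (dvar : X -> A -> A) (ev : (X -> A) -> A -> A)
    (vf : (X -> A) -> A -> A) (deg : A -> nat) : Prop := PolynomialModel {
  pm_char : forall m : nat, m.+1%:R != 0 :> K;
  pm_ind : forall S : A -> Prop,
    (forall c, S c%:A) -> (forall Q R, S Q -> S R -> S (Q + R)) ->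
    (forall Q R, S Q -> S R -> S (Q * R)) -> (forall x, S (var x)) ->
    forall P, S P;
  pm_dvar_der : forall x, derivation (dvar x);
  pm_dvar_var : forall x y, dvar x (var y) = (x == y)%:R;
  pm_ev_alg : forall b c, ev b c%:A = c%:A;
  pm_evD : forall b P Q, ev b (P + Q) = ev b P + ev b Q;
  pm_evM : forall b P Q, ev b (P * Q) = ev b P * ev b Q;
  pm_ev_var : forall b x, ev b (var x) = b x;
  pm_ev_closed : forall (S : A -> Prop) b P,
    (forall c, S c%:A) -> (forall Q R, S Q -> S R -> S (Q + R)) ->
    (forall Q R, S Q -> S R -> S (Q * R)) ->
    (forall x, dvar x P != 0 -> S (b x)) -> S (ev b P);
  pm_eq_ev : forall b b' P,
    (forall x, dvar x P != 0 -> b x = b' x) -> ev b P = ev b' P;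
  pm_vf_der : forall f, derivation (vf f);
  pm_vf_var : forall f x, vf f (var x) = f x;
  pm_const : forall P, (forall x, dvar x P = 0) -> exists c, P = c%:A;
  pm_deg_eq0 : forall P, deg P = 0%N -> P = 0;
  pm_deg_dvar : forall x P d, (deg P <= d.+1)%N -> (deg (dvar x P) <= d)%N
}.

Section ModelTheory.

Variables (K : fieldType) (X : eqType) (A : comAlgType K).
Variables (var : X -> A) (dvar : X -> A -> A) (ev : (X -> A) -> A -> A).
Variables (vf : (X -> A) -> A -> A) (deg : A -> nat).
Hypothesis PM : polynomial_model var dvar ev vf deg.

Lemma ev0 b : ev b 0 = 0.
Proof. by have := pm_ev_alg PM b 0; rewrite !scale0r. Qed.

Lemma ev1 b : ev b 1 = 1.
Proof. by have := pm_ev_alg PM b 1; rewrite !scale1r. Qed.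

Lemma ev_var_id P : ev var P = P.
Proof.
elim/(pm_ind PM): P => [c|P Q IHP IHQ|P Q IHP IHQ|x].
- exact: (pm_ev_alg PM).
- by rewrite (pm_evD PM) IHP IHQ.
- by rewrite (pm_evM PM) IHP IHQ.
- exact: (pm_ev_var PM).
Qed.

Lemma ev_comp b b' P : ev b (ev b' P) = ev (fun x => ev b (b' x)) P.
Proof.
elim/(pm_ind PM): P => [c|P Q IHP IHQ|P Q IHP IHQ|x].
- by rewrite !(pm_ev_alg PM).
- by rewrite !(pm_evD PM) IHP IHQ.
- by rewrite !(pm_evM PM) IHP IHQ.
- by rewrite !(pm_ev_var PM).
Qed.

Lemma derivation_eq0 D :
  derivation D -> (forall x, D (var x) = 0) -> forall P, D P = 0.
Proof.
move=> dD D0; apply: (pm_ind PM) => // [c|P Q P0 Q0|P Q P0 Q0].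
- exact: drv_alg.
- by rewrite (drvD dD) P0 Q0 addr0.
- by rewrite (drvM dD) P0 Q0 mul0r mulr0 addr0.
Qed.

Lemma eq_derivation D E : derivation D -> derivation E ->
  (forall x, D (var x) = E (var x)) -> D =1 E.
Proof.
move=> dD derE DE P; apply/eqP; rewrite -subr_eq0; apply/eqP.
apply: (derivation_eq0 (derivation_sub dD derE)) => x.
by rewrite DE subrr.
Qed.

(** Only finitely many summands are nonzero; the sequence [s0] contains all
    variables of P. *)
Lemma chain_rule D b P : derivation D ->
  exists s0 : seq X, forall s, uniq s -> {subset s0 <= s} ->
    D (ev b P) = \sum_(x <- s) ev b (dvar x P) * D (b x).
Proof.
move=> dD; elim/(pm_ind PM): P => [c|P Q|P Q|x].
- exists [::] => s _ _; rewrite (pm_ev_alg PM) (drv_alg dD) big1 // => x _.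
  by rewrite (drv_alg (pm_dvar_der PM x)) ev0 mul0r.
- move=> [sP IHP] [sQ IHQ]; exists (sP ++ sQ) => s us sub.
  rewrite (pm_evD PM) (drvD dD) (IHP s) ?(IHQ s) => //; first last.
  + by move=> x xs; apply: sub; rewrite mem_cat xs.
  + by move=> x xs; apply: sub; rewrite mem_cat xs orbT.
  rewrite -big_split; apply: eq_bigr => x _ /=.
  by rewrite (drvD (pm_dvar_der PM x)) (pm_evD PM) mulrDl.
- move=> [sP IHP] [sQ IHQ]; exists (sP ++ sQ) => s us sub.
  rewrite (pm_evM PM) (drvM dD) (IHP s) ?(IHQ s) => //; first last.
  + by move=> x xs; apply: sub; rewrite mem_cat xs.
  + by move=> x xs; apply: sub; rewrite mem_cat xs orbT.
  rewrite mulr_suml mulr_sumr -big_split; apply: eq_bigr => x _ /=.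
  rewrite (drvM (pm_dvar_der PM x)) (pm_evD PM) !(pm_evM PM); ring.
- exists [:: x] => s us sub; rewrite (pm_ev_var PM) (bigD1_seq x) //=; last first.
    by apply: sub; rewrite inE.
  rewrite (pm_dvar_var PM) eqxx ev1 mul1r big1 ?addr0 // => y /negPf yx.
  by rewrite (pm_dvar_var PM) yx ev0 mul0r.
Qed.

End ModelTheory.

Section ChainRuleLevel.

Variables (K : fieldType) (I : finType) (A : comAlgType K).
Variables (var : I * nat -> A) (dvar : I * nat -> A -> A).
Variables (ev : (I * nat -> A) -> A -> A).
Variables (vf : (I * nat -> A) -> A -> A) (deg : A -> nat).
Hypothesis PM : polynomial_model var dvar ev vf deg.

Lemma chain_rule_level D b P r : derivation D ->
  (forall i s, s != r -> ev b (dvar (i, s) P) * D (b (i, s)) = 0) ->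
  D (ev b P) = \sum_i ev b (dvar (i, r) P) * D (b (i, r)).
Proof.
move=> dD vanish; have [s0 chain] := chain_rule PM b P dD.
pose lev := [seq (i, r) | i <- enum I].
rewrite (chain (undup (s0 ++ lev))) ?undup_uniq //; last first.
  by move=> x xs; rewrite mem_undup mem_cat xs.
rewrite (bigID (fun x : I * nat => x.2 == r)) /=.
rewrite [X in _ + X]big1 ?addr0 => [|[i s] /= sr]; last exact: vanish.
rewrite -big_filter (perm_big lev); last first.
  apply: uniq_perm; first by rewrite filter_uniq ?undup_uniq.
    by rewrite map_inj_uniq ?enum_uniq // => i j [].
  move=> [i s]; rewrite mem_filter mem_undup mem_cat /=.
  case: (eqVneq s r) => [->|sr] /=.
    have -> : (i, r) \in lev by apply: map_f; rewrite mem_enum.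
    by rewrite orbT.
  by apply/esym/negP => /mapP[j _ [_ e]]; rewrite e eqxx in sr.
by rewrite /lev big_map big_enum.
Qed.

End ChainRuleLevel.

Section LinearSystems.

Variables (K : fieldType) (V : lmodType K) (n : nat) (M : 'M[K]_n).
Hypothesis unitM : M \in unitmx.

Lemma linear_system_eq0 (x : 'I_n -> V) :
  (forall l, \sum_i M i l *: x i = 0) -> forall i, x i = 0.
Proof.
move=> Mx k.
have : \sum_l invmx M l k *: (\sum_i M i l *: x i) = 0.
  by rewrite big1 // => l _; rewrite Mx scaler0.
under eq_bigr do rewrite scaler_sumr.
rewrite exchange_big /= => <-.
transitivity (\sum_i (M *m invmx M) i k *: x i).
  rewrite mulmxV // (bigD1 k) //= big1 ?addr0 => [|i /negPf ik].
    by rewrite mxE eqxx scale1r.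
  by rewrite mxE ik scale0r.
apply: eq_bigr => i _; rewrite mxE scaler_suml; apply: eq_bigr => l _.
by rewrite scalerA mulrC.
Qed.

Lemma linear_system_solve (x y : 'I_n -> V) :
  (forall j, \sum_l M j l *: x l = y j) ->
  forall l, x l = \sum_j invmx M l j *: y j.
Proof.
move=> Mx l; under eq_bigr => j _ do rewrite -Mx scaler_sumr.
rewrite exchange_big /=.
transitivity (\sum_i (invmx M *m M) l i *: x i).
  rewrite mulVmx // (bigD1 l) //= big1 ?addr0 => [|i /negPf il].
    by rewrite mxE eqxx scale1r.
  by rewrite mxE eq_sym il scale0r.
apply: eq_bigr => i _; rewrite mxE scaler_suml; apply: eq_bigr => j _.
by rewrite scalerA.
Qed.

End LinearSystems.

(** * Triangular changes of variables *)

Section Triangular.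

Variables (K : fieldType) (n : nat) (A : comAlgType K).
Variables (var : 'I_n * nat -> A) (dvar : 'I_n * nat -> A -> A).
Variables (ev : ('I_n * nat -> A) -> A -> A).
Variables (vf : ('I_n * nat -> A) -> A -> A) (deg : A -> nat).
Hypothesis PM : polynomial_model var dvar ev vf deg.

(** In characteristic zero: P is a polynomial in the variables of level less
    than s. *)
Definition below (s : nat) (P : A) : Prop :=
  forall i r, (s <= r)%N -> dvar (i, r) P = 0.

Lemma below_alg s c : below s c%:A.
Proof. by move=> i r _; apply: drv_alg; exact: (pm_dvar_der PM). Qed.

Lemma belowD s P Q : below s P -> below s Q -> below s (P + Q).
Proof. by move=> bP bQ i r sr; rewrite (drvD (pm_dvar_der PM _)) bP ?bQ ?addr0. Qed.

Lemma belowM s P Q : below s P -> below s Q -> below s (P * Q).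
Proof. by move=> bP bQ i r sr; rewrite (drvM (pm_dvar_der PM _)) bP ?bQ ?mul0r ?mulr0 ?addr0. Qed.

Lemma belowZ s c P : below s P -> below s (c *: P).
Proof. by move=> bP; rewrite -mulr_algl; apply: belowM => //; exact: below_alg. Qed.

Lemma below0 s : below s 0.
Proof. by rewrite -(scale0r 1); exact: below_alg. Qed.

Lemma below_sum s I (t : seq I) (p : pred I) (F : I -> A) :
  (forall i, below s (F i)) -> below s (\sum_(i <- t | p i) F i).
Proof.
by move=> bF; apply: (big_ind (below s)) => //; [exact: below0|exact: belowD].
Qed.

Lemma belowW s s' P : (s <= s')%N -> below s P -> below s' P.
Proof. by move=> ss' bP i r s'r; apply: bP; exact: leq_trans s'r. Qed.

Lemma below_var s i r : (r < s)%N -> below s (var (i, r)).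
Proof.
move=> rs j q sq; rewrite (pm_dvar_var PM) xpair_eqE.
by rewrite (gtn_eqF (leq_trans rs sq)) andbF.
Qed.

Lemma below_exists P : exists s, below s P.
Proof.
elim/(pm_ind PM): P => [c|P Q [s bP] [s' bQ]|P Q [s bP] [s' bQ]|[i r]].
- by exists 0%N; exact: below_alg.
- exists (maxn s s').
  by apply: belowD; [apply: belowW bP|apply: belowW bQ]; rewrite leq_max leqnn ?orbT.
- exists (maxn s s').
  by apply: belowM; [apply: belowW bP|apply: belowW bQ]; rewrite leq_max leqnn ?orbT.
- by exists r.+1; exact: below_var.
Qed.

Variables (M : 'M[K]_n) (u : 'I_n -> nat -> A) (w : nat -> K).
Variable b : ('I_n * nat)%type -> A.
Hypothesis unitM : M \in unitmx.
Hypothesis wN0 : forall r, w r != 0.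
Hypothesis uE : forall i r, u i r = w r *: var (i, r).
Hypothesis b_lead : forall j r, below r (b (j, r) - \sum_l M j l *: u l r).

Lemma dvar_lead j l r : dvar (l, r) (b (j, r)) = (M j l * w r)%:A.
Proof.
have derl := pm_dvar_der PM (l, r).
have /eqP := b_lead j l (leqnn r); rewrite (drvB derl) subr_eq0 => /eqP->.
rewrite (drv_sum derl) (bigD1 l) //= big1 ?addr0 => [|i /negPf il].
  by rewrite (drvZ derl) uE (drvZ derl) (pm_dvar_var PM) eqxx scalerA.
rewrite (drvZ derl) uE (drvZ derl) (pm_dvar_var PM) xpair_eqE eq_sym il.
by rewrite !scaler0.
Qed.

Lemma dvar_lead_gt j l r s : (s < r)%N -> dvar (l, r) (b (j, s)) = 0.
Proof.
move=> sr; have -> : b (j, s) =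
    b (j, s) - \sum_i M j i *: u i s + \sum_i M j i *: u i s by rewrite subrK.
apply: (belowD (s := r)) => //; first exact: (belowW (ltnW sr)).
by apply: below_sum => i; apply: belowZ; rewrite uE; apply/belowZ/below_var.
Qed.

(** Differentiating a relation with respect to the variables of its highest
    level r involves only the invertible matrix M, so all the partial
    derivatives of the relation at level r are again relations, of lower
    degree; hence they vanish, and one can pass to the next lower level. *)
Lemma triangular_inj Q : ev b Q = 0 -> Q = 0.
Proof.
have [d] := ubnP (deg Q); elim: d Q => // d IHd Q; rewrite ltnS => degQ bQ.
case: (posnP d) degQ => [->|d0] degQ.
  by apply: (pm_deg_eq0 PM); apply/eqP; rewrite -leqn0.
have dQ0 x : dvar x Q = 0.
  have [N bN] := below_exists Q.
  suff lev k i r : (N <= r + k)%N -> dvar (i, r) Q = 0.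
    by case: x => i r; apply: (lev N); exact: leq_addl.
  elim: k i r => [|k IHk] i r; first by rewrite addn0 => /bN.
  move=> Nrk; apply: IHd; first by rewrite -(prednK d0) ltnS; apply: (pm_deg_dvar PM); rewrite prednK.
  have gtr l s : (r < s)%N -> dvar (l, s) Q = 0.
    by move=> rs; apply: IHk; lia.
  move: i; apply: (linear_system_eq0 unitM) => l.
  have := drv0 (pm_dvar_der PM (l, r)).
  rewrite -{1}bQ (chain_rule_level PM (b := b) (r := r)).
  - under eq_bigr do rewrite dvar_lead mulr_algr mulrC -scalerA.
    rewrite -scaler_sumr => /eqP; rewrite scaler_eq0 (negPf (wN0 r)) /=.
    by move/eqP.
  - exact: (pm_dvar_der PM).
  - move=> i s; rewrite neq_ltn => /orP[sr|rs].
      by rewrite dvar_lead_gt // mulr0.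
    by rewrite gtr // (ev0 PM) mul0r.
have [c Qc] := pm_const PM dQ0.
move/eqP: bQ; rewrite Qc (pm_ev_alg PM) scaler_eq0 oner_eq0 orbF => /eqP->.
by rewrite scale0r.
Qed.

(** Since M is invertible, the coordinates of level r determine the variables of
    level r modulo polynomials in the variables of lower level. *)
Lemma triangular_surj P : exists Q, P = ev b Q.
Proof.
pose im P := exists Q, P = ev b Q.
have imC c : im c%:A by exists c%:A; rewrite (pm_ev_alg PM).
have imD P1 P2 : im P1 -> im P2 -> im (P1 + P2).
  by move=> [Q1 ->] [Q2 ->]; exists (Q1 + Q2); rewrite (pm_evD PM).
have imM P1 P2 : im P1 -> im P2 -> im (P1 * P2).
  by move=> [Q1 ->] [Q2 ->]; exists (Q1 * Q2); rewrite (pm_evM PM).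
have imZ c P1 : im P1 -> im (c *: P1) by rewrite -mulr_algl; exact: imM.
have im_sum (F : 'I_n -> A) : (forall i, im (F i)) -> im (\sum_i F i).
  move=> imF; apply: (big_ind im) => //.
  by rewrite -(scale0r 1).
suff imX i r : im (var (i, r)).
  by apply: (pm_ind PM (S := im)) => // -[i r]; exact: imX.
have [N] := ubnP r; elim: N i r => // N IHN i r; rewrite ltnS => rN.
suff imu : im (u i r).
  have -> : var (i, r) = (w r)^-1 *: u i r by rewrite uE scalerA mulVf ?scale1r.
  exact: imZ.
rewrite (linear_system_solve unitM (x := u^~ r) (fun=> erefl)).
apply: im_sum => j; apply: (imZ).
have -> : \sum_l M j l *: u l r =
    b (j, r) + (-1) *: (b (j, r) - \sum_l M j l *: u l r).
  by rewrite scaleN1r opprB addrC subrK.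
apply: (imD); first by exists (var (j, r)); rewrite (pm_ev_var PM).
apply: (imZ); rewrite -[X in im X](ev_var_id PM).
apply: (pm_ev_closed PM) => // -[l s] nz; apply: IHN; apply: leq_trans rN.
by rewrite ltnNge; apply: contra_neqN nz => rs; exact: b_lead.
Qed.

End Triangular.

(** * Differential polynomials *)

Section DifferentialPolynomials.

Variables (K : fieldType) (n : nat) (A : comAlgType K).
Variables (var : 'I_n * nat -> A) (dvar : 'I_n * nat -> A -> A).
Variables (ev : ('I_n * nat -> A) -> A -> A).
Variables (vf : ('I_n * nat -> A) -> A -> A) (deg : A -> nat).
Hypothesis PM : polynomial_model var dvar ev vf deg.

Variable T : A -> A.
Hypothesis derT : derivation T.
Hypothesis T_var : forall i r, T (var (i, r)) = r.+1%:R * var (i, r.+1).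

Definition jet (i : 'I_n) (r : nat) : A := iter r T (var (i, 0%N)).

Lemma jetS i r : jet i r.+1 = T (jet i r).
Proof. by []. Qed.

Lemma jetE i r : jet i r = r`!%:R *: var (i, r).
Proof.
elim: r => [|r IHr]; first by rewrite fact0 scale1r.
rewrite jetS IHr (drvZ derT) T_var factS mulnC natrM -scalerA.
by congr (_ *: _); rewrite scaler_nat mulr_natl.
Qed.

Lemma fact_neq0 r : r`!%:R != 0 :> K.
Proof. by rewrite -(prednK (fact_gt0 r)) (pm_char PM). Qed.

Lemma varE i r : var (i, r) = r`!%:R^-1 *: jet i r.
Proof. by rewrite jetE scalerA mulVf ?scale1r ?fact_neq0. Qed.

Lemma derivation_jet_eq0 D : derivation D ->
  (forall i r, D (jet i r) = 0) -> forall P, D P = 0.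
Proof.
move=> dD D0; apply: (derivation_eq0 PM dD) => -[i r].
by rewrite varE (drvZ dD) D0 scaler0.
Qed.

Lemma eq_derivation_jet D E : derivation D -> derivation E ->
  (forall i r, D (jet i r) = E (jet i r)) -> D =1 E.
Proof.
move=> dD dE DE; apply: (eq_derivation PM dD dE) => -[i r].
by rewrite varE (drvZ dD) (drvZ dE) DE.
Qed.

Lemma dvar_T i r P :
  dvar (i, r.+1) (T P) = T (dvar (i, r.+1) P) + r.+1%:R * dvar (i, r) P.
Proof.
have dd := pm_dvar_der PM.
have := eq_derivation PM (derivation_comm (dd (i, r.+1)) derT)
  (derivation_mul r.+1%:R (dd (i, r))).
move=> /(_ _ P) <-; first by rewrite addrC subrK.
move=> [j q]; rewrite T_var (drvM (dd _)) !(pm_dvar_var PM).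
rewrite -[q.+1%:R]scaler_nat (drv_alg (dd _)) -[X in T X]scaler_nat.
rewrite (drv_alg derT) mul0r add0r subr0 scaler_nat !xpair_eqE eqSS.
by case: (i == j) => //=; rewrite ?mulr0 //; case: eqVneq => [->|]; rewrite ?mulr0.
Qed.

Lemma below_T s P : below dvar s P -> below dvar s.+1 (T P).
Proof.
move=> bP i [|r] // sr; rewrite dvar_T !bP ?(drv0 derT) ?mulr0 ?addr0 //.
exact: leqW.
Qed.

(** * Generators of the algebra annihilated by derivations *)

Variables (M c : 'M[K]_n) (B : 'I_n -> A) (e : 'I_n -> nat).
Variables (W : A -> Prop) (Y : 'I_n -> nat -> A -> A).

Hypothesis B_lead :
  forall j, below dvar (e j) (B j - \sum_l M j l *: jet l (e j)).
Hypothesis derY : forall k s, derivation (Y k s).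
Hypothesis Y_W : forall k s P, (s < e k)%N -> W P -> Y k s P = 0.
Hypothesis Y_jet_lt :
  forall k s l r, (s < e k)%N -> (r < s)%N -> Y k s (jet l r) = 0.
Hypothesis Y_jet : forall k s l, (s < e k)%N -> Y k s (jet l s) = (c k l)%:A.
Hypothesis pairing_lt :
  forall j k : 'I_n, (j < k)%N -> \sum_l M j l * c k l = 0.
Hypothesis pairing_diag : forall j : 'I_n, \sum_l M j l * c j l != 0.
Hypothesis W_alg : forall a, W a%:A.
Hypothesis WD : forall P Q, W P -> W Q -> W (P + Q).
Hypothesis WM : forall P Q, W P -> W Q -> W (P * Q).
Hypothesis W_T : forall P, W P -> W (T P).
Hypothesis W_B : forall j, W (B j).

Let TB (x : 'I_n * nat) : A := iter x.2 T (B x.1).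

Let W_TB x : W (TB x).
Proof. by rewrite /TB; elim: x.2 => //= r IHr; exact: W_T. Qed.

(** The jets of the generators, completed at the levels below the exponents
    by the linear forms that lead the generators. *)
Let coord (x : 'I_n * nat) : A :=
  if (e x.1 <= x.2)%N then TB (x.1, x.2 - e x.1)%N
  else \sum_l M x.1 l *: jet l x.2.

Let coord_lead j r :
  below dvar r (coord (j, r) - \sum_l M j l *: jet l r).
Proof.
rewrite /coord /=; case: ifP => [er|_]; last first.
  by rewrite subrr; exact: (below0 PM).
rewrite -{1 3}(subnKC er) /TB /=; elim: (r - e j)%N => [|q IHq] /=.
  by rewrite addn0.
have -> : \sum_l M j l *: jet l (e j + q.+1) =
          T (\sum_l M j l *: jet l (e j + q)).
  by rewrite (drv_sum derT); apply: eq_bigr => l _; rewrite (drvZ derT) addnS.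
by rewrite -(drvB derT) addnS; exact: below_T.
Qed.

Let pairing_unit : M \in unitmx.
Proof.
suff : M *m c^T \in unitmx by rewrite unitmx_mul => /andP[].
have GE j k : (M *m c^T) j k = \sum_l M j l * c k l.
  by rewrite mxE; apply: eq_bigr => l _; rewrite mxE.
rewrite unitmxE det_trig; last by apply/is_trig_mxP => j k jk; rewrite GE pairing_lt.
by rewrite unitfE; apply/prodf_neq0 => j _; rewrite GE.
Qed.

Let coord_inj Q : ev coord Q = 0 -> Q = 0.
Proof. exact: (triangular_inj PM pairing_unit fact_neq0 jetE coord_lead). Qed.

Lemma generators_alg_independent Q : ev TB Q = 0 -> Q = 0.
Proof.
move=> Q0.
pose up (x : 'I_n * nat) := var (x.1, x.2 + e x.1)%N.
pose down (x : 'I_n * nat) := var (x.1, x.2 - e x.1)%N.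
have upQ0 : ev up Q = 0.
  apply: coord_inj; rewrite (ev_comp PM) -Q0; apply: (pm_eq_ev PM) => -[j r] _.
  by rewrite /up (pm_ev_var PM) /coord /= leq_addl addnK.
have <- : ev down (ev up Q) = Q.
  rewrite (ev_comp PM) -[RHS](ev_var_id PM); apply: (pm_eq_ev PM) => -[j r] _.
  by rewrite /up (pm_ev_var PM) /down /= addnK.
by rewrite upQ0 (ev0 PM).
Qed.

(** An element of W is a polynomial Q in the coordinates [coord].  The
    derivations Y k s annihilate W, hence the jets of the generators, and they
    act on the remaining coordinates in a triangular way with nonzero constants
    on the diagonal; so Q does not involve the remaining coordinates. *)
Lemma generators_generate P : W P <-> exists Q, P = ev TB Q.
Proof.
split=> [WP|[Q ->]]; last first.
  by apply: (pm_ev_closed PM) => // x _; exact: W_TB.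
have [Q PQ] :=
  triangular_surj PM pairing_unit fact_neq0 jetE coord_lead P.
have [N bN] := below_exists PM Q.
have Y_coord k s i r : (s < e k)%N -> (e i <= r)%N -> Y k s (coord (i, r)) = 0.
  by move=> sk ir; apply: Y_W => //; rewrite /coord /= ir; exact: W_TB.
have Y_form k s i r : (s < e k)%N -> (r < e i)%N ->
    Y k s (coord (i, r)) = \sum_l M i l *: Y k s (jet l r).
  move=> sk ri; rewrite /coord /= leqNgt ri (drv_sum (derY k s)).
  by apply: eq_bigr => l _; rewrite (drvZ (derY k s)).
have Q_low d s : (N <= s + d)%N ->
    forall i, (s < e i)%N -> dvar (i, s) Q = 0.
  elim: d s => [|d IHd] s Nsd i si; first by rewrite bN // -(addn0 s).
  apply: coord_inj.
  have high j r : (s < r)%N -> (r < e j)%N -> dvar (j, r) Q = 0.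
    by move=> sr; apply: IHd; lia.
  have eqk k : (s < e k)%N ->
      \sum_j ev coord (dvar (j, s) Q) * Y k s (coord (j, s)) = 0.
    move=> sk; rewrite -(chain_rule_level PM) => //.
      by rewrite -PQ Y_W.
    move=> j r rs; case: (leqP (e j) r) => [jr|rj].
      by rewrite Y_coord ?mulr0.
    move: rs; rewrite neq_ltn => /orP[rs|sr].
      by rewrite Y_form // big1 ?mulr0 // => l _; rewrite Y_jet_lt ?scaler0.
    by rewrite high // (ev0 PM) mul0r.
  move: si; have [m] := ubnP (n - i); elim: m i => // m IHm i; rewrite ltnS => im si.
  have := eqk i si; rewrite (bigD1 i) //= big1 ?addr0 => [|j ji].
    rewrite Y_form //; under eq_bigr do rewrite Y_jet // scalerA.
    rewrite -scaler_suml mulr_algr => /eqP.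
    by rewrite scaler_eq0 (negPf (pairing_diag i)) => /eqP.
  case: (leqP (e j) s) => [js|sj]; first by rewrite Y_coord ?mulr0.
  case: (ltngtP i j) => [ij|jlti|ij]; last by move: ji; rewrite (val_inj ij) eqxx.
    by rewrite IHm ?mul0r //; have := ltn_ord j; lia.
  rewrite Y_form //; under eq_bigr do rewrite Y_jet // scalerA.
  by rewrite -scaler_suml pairing_lt // scale0r mulr0.
exists (ev (fun x => var (x.1, x.2 - e x.1)%N) Q).
rewrite (ev_comp PM) PQ; apply: (pm_eq_ev PM) => -[j r] /= nz.
rewrite (pm_ev_var PM) /coord /=; case: leqP => // rj.
by move/eqP: nz; rewrite (Q_low N) ?leq_addl.
Qed.

End DifferentialPolynomials.

(** * The vector representation of the Lie algebra of type D *)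

Section Nodes.

Variables (K : fieldType) (n : nat).

Local Notation node := ('I_n * bool)%type.

(** The nodes (i, false) and (i, true) stand for the basis vectors of weights eps_i
    and - eps_i of the vector representation.  The depth is the number of simple
    roots to be subtracted from the highest weight; the two vectors of depth n - 1
    are those of weights eps_n and - eps_n.  Pairs of basis vectors index the
    exterior square, which is the adjoint representation, and [pos] selects
    the pairs of positive height. *)
Definition depth (a : node) : nat :=
  if a.2 then ((n.-1).*2 - a.1)%N else a.1.

Definition dual (a : node) : node := (a.1, ~~ a.2).

Definition pos (a b : node) : bool := (depth a + depth b < (n.-1).*2)%N.

Definition wt (a : node) (l : 'I_n) : K := (-1) ^+ a.2 *+ (a.1 == l).

Lemma dualK a : dual (dual a) = a.
Proof. by case: a => x s; rewrite /dual /= negbK. Qed.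

Lemma dual_neq a : (dual a == a) = false.
Proof. by case: a => x []; rewrite /dual xpair_eqE eqxx. Qed.

Lemma eq_dual a b : (b == dual a) = (a == dual b).
Proof. by apply/eqP/eqP => ->; rewrite dualK. Qed.

Lemma depth_le a : (depth a <= (n.-1).*2)%N.
Proof. by case: a => [[x xn] []]; rewrite /depth /=; lia. Qed.

Lemma depth_dual a : (depth a + depth (dual a))%N = (n.-1).*2.
Proof. by case: a => [[x xn] []]; rewrite /depth /=; lia. Qed.

Lemma depth_eq a c :
  (depth c == depth a) = (c == a) || (depth a == n.-1) && (c == dual a).
Proof.
case: a c => [[x xn] s] [[y yn] t]; rewrite /depth /dual !xpair_eqE -!val_eqE /=.
by case: s; case: t => /=; rewrite ?andbT ?andbF ?orbF; lia.
Qed.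

Lemma posC a b : pos a b = pos b a.
Proof. by rewrite /pos addnC. Qed.

Lemma wt_dual a l : wt (dual a) l = - wt a l.
Proof. by rewrite /wt signrN mulNrn. Qed.

Section Action.

Variable V : zmodType.

(** The principal nilpotent element maps the basis vector at a node a to the
    sum of the basis vectors at the nodes of the next depth; [shift1] and [shift]
    are the transposes of its action on vectors and on pairs of vectors. *)
Definition shift1 (F : node -> V) (a : node) : V :=
  \sum_(c | depth c == (depth a).+1) F c.

Definition shift (F : node -> node -> V) (a b : node) : V :=
  shift1 (F^~ b) a + shift1 (F a) b.

Lemma shift_ext F G a b : (forall c d, F c d = G c d) -> shift F a b = shift G a b.
Proof.
by move=> FG; congr (_ + _); apply: eq_bigr => c _; rewrite FG.
Qed.

(** [shift] raises the sum of the depths by 1. *)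
Lemma shift_ext_at F G a b :
  (forall c d, (depth c + depth d)%N = (depth a + depth b).+1 -> F c d = G c d) ->
  shift F a b = shift G a b.
Proof.
move=> FG; congr (_ + _); apply: eq_bigr => c /eqP dc; apply: FG.
  by rewrite dc addSn.
by rewrite dc addnS.
Qed.

Lemma shiftD F G a b :
  shift (fun c d => F c d + G c d) a b = shift F a b + shift G a b.
Proof. by rewrite /shift /shift1 !big_split addrACA. Qed.

Lemma shift_antisym F : (forall a b, F b a = - F a b) ->
  forall a b, shift F b a = - shift F a b.
Proof.
move=> Fanti a b; rewrite /shift addrC opprD; congr (_ + _);
  by rewrite -sumrN; apply: eq_bigr => c _; rewrite Fanti.
Qed.

Lemma shift0 a b : shift (fun _ _ : node => 0 : V) a b = 0.
Proof. by rewrite /shift /shift1 !big1 ?addr0. Qed.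

Lemma sum_depth (F : node -> V) a : \sum_(c | depth c == depth a) F c =
  F a + (if depth a == n.-1 then F (dual a) else 0).
Proof.
under eq_bigl do rewrite depth_eq.
case: ifP => [_|_]; last by rewrite (big_pred1 a) ?addr0 // => c; rewrite orbF.
rewrite (bigD1 a) ?eqxx //=; congr (_ + _); rewrite (big_pred1 (dual a)) // => c.
by case: (eqVneq c a) => [->|_]; rewrite /= ?andbF ?andbT // eq_sym dual_neq.
Qed.

Lemma sum_if_eq (p : pred node) (F : V) x :
  \sum_(c | p c) (if c == x then F else 0) = if p x then F else 0.
Proof.
rewrite -big_mkcondr; case px: (p x).
  by rewrite (big_pred1 x) // => c /=; case: eqVneq => [->|_]; rewrite ?andbF ?px.
by rewrite big_pred0 // => c; case: eqVneq => [->|_]; rewrite ?andbF ?px.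
Qed.

End Action.

Lemma shift_morph (V V' : zmodType) (f : V -> V') F a b :
  (forall x y, f (x + y) = f x + f y) -> f 0 = 0 ->
  f (shift F a b) = shift (fun c d => f (F c d)) a b.
Proof.
move=> fD f0; rewrite /shift fD /shift1; congr (_ + _); exact: (big_morph f fD f0).
Qed.

Lemma shift_scale (V : lmodType K) (F : node -> node -> K) (v : V) a b :
  shift (fun c d => F c d *: v) a b = shift F a b *: v.
Proof.
by rewrite (shift_morph F a b (fun x y => scalerDl v x y)) ?scale0r.
Qed.

(** The component along l of the element of the Cartan subalgebra represented by
    the pair (a, b) of basis vectors.  The sign (-1) ^+ a.1 results from rescaling
    the basis so that all coefficients of the principal nilpotent element are 1. *)
Definition cartan (l : 'I_n) (a b : node) : K :=
  if b == dual a then (-1) ^+ a.1 * wt a l else 0.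

Lemma cartan_antisym l a b : cartan l b a = - cartan l a b.
Proof.
rewrite /cartan eq_dual; case: eqP => [->|_]; last by rewrite oppr0.
by rewrite wt_dual mulrN /=.
Qed.

Lemma cartan_depth l a b : (depth a + depth b)%N != (n.-1).*2 -> cartan l a b = 0.
Proof. by rewrite /cartan; case: (b =P dual a) => // ->; rewrite depth_dual eqxx. Qed.

(** * Simple roots *)

Section SimpleRoot.

Variables (i j : 'I_n) (b : bool).
Hypothesis depth_j : depth (j, b) = i.+1.
Hypothesis i_lt : (i.+1 < n)%N.

Definition coroot (l : 'I_n) : K := wt (i, false) l - wt (j, b) l.

Definition coroot_wt (a : node) : K := (-1) ^+ a.2 * coroot a.1.

Lemma simple_neq : i != j.
Proof.
by apply/eqP => ij; move: depth_j; rewrite -ij /depth /=; case: b => /=; lia.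
Qed.

Lemma depth_dual_j : depth (j, ~~ b) = ((n.-1).*2 - i.+1)%N.
Proof. by have := depth_dual (j, b); rewrite depth_j /dual /=; lia. Qed.

Lemma depth_i_true : depth (i, true) = (depth (j, ~~ b)).+1.
Proof. by rewrite depth_dual_j /depth /=; lia. Qed.

Lemma coroot_wt_cases a :
  coroot_wt a = (a == (i, false))%:R - (a == (i, true))%:R
                - ((a == (j, b))%:R - (a == (j, ~~ b))%:R).
Proof.
case: a => x s; rewrite /coroot_wt /coroot /wt /= !xpair_eqE ![_ == x]eq_sym.
have [->|xi] := eqVneq x i.
  by rewrite (negPf simple_neq) mulr0n !mulr1n; case: (s) => /=; ring.
have [_|_] := eqVneq x j; last by rewrite !mulr0n !subr0 mulr0.
by rewrite mulr0n !mulr1n; case: (s); case: (b) => /=; ring.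
Qed.

Section RaisingAction.

Variable V : lmodType K.

(** The simple root vector maps the basis vector at (j, b) to the one at
    (i, false), and the one at (i, true) to the one at (j, ~~ b). *)
Definition raise1 (F : node -> V) (a : node) : V :=
  (if a == (j, b) then F (i, false) else 0) +
  (if a == (i, true) then F (j, ~~ b) else 0).

Definition raise (F : node -> node -> V) (a c : node) : V :=
  raise1 (F^~ c) a + raise1 (F a) c.

(** The commutator of a simple root vector with the principal nilpotent element
    is the corresponding coroot. *)
Lemma raise1_shift1 F a :
  raise1 (shift1 F) a = shift1 (raise1 F) a - coroot_wt a *: F a.
Proof.
have depi : depth (i, false) = i by [].
have ne_it : (depth (i, true) == n.-1) = false.
  by apply/negbTE; rewrite /depth /=; lia.
have ne_if : (depth (i, false) == n.-1) = false.
  by apply/negbTE; rewrite /depth /=; lia.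
have -> : raise1 (shift1 F) a =
   (if a == (j, b) then F (j, b) +
      (if depth (j, b) == n.-1 then F (j, ~~ b) else 0) else 0) +
   (if a == (i, true) then F (i, true) else 0).
  rewrite /raise1 /shift1 depi -depth_i_true -depth_j !sum_depth ne_it addr0.
  by [].
have -> : shift1 (raise1 F) a = (if a == (i, false) then F (i, false) else 0) +
   (if (a == (j, ~~ b)) || (depth (j, b) == n.-1) && (a == (j, b))
    then F (j, ~~ b) else 0).
  rewrite /shift1 /raise1 big_split /= !sum_if_eq depth_j eqSS depth_i_true eqSS.
  rewrite eq_sym -[X in _ == X]depi depth_eq ne_if /= orbF.
  rewrite [depth (j, ~~ b) == _]eq_sym depth_eq /dual /= negbK.
  have -> : (depth (j, ~~ b) == n.-1) = (depth (j, b) == n.-1).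
    by have := depth_dual (j, b); rewrite /dual /=; lia.
  by rewrite depth_j.
rewrite coroot_wt_cases.
case: a => x s; rewrite !xpair_eqE.
have := simple_neq.
have [-> ij|xi _] := eqVneq x i.
  rewrite (negPf ij) /= ?andbF ?orbF.
  case: (s) => /=; rewrite ?subr0 ?sub0r ?addr0 ?add0r ?scaleN1r ?opprK //.
  by rewrite scale1r subrr.
have [->|_] /= := eqVneq x j; last by rewrite !andbF !subr0 scale0r !addr0 subr0.
case: (depth (j, b) == n.-1); case: (s); case: (b) => /=;
  rewrite ?subr0 ?sub0r ?add0r ?addr0 ?opprK ?scaleN1r ?opprK ?scale1r ?subrr //.
all: by rewrite addrC.
Qed.

Lemma raise_shift F a c : raise (shift F) a c =
  shift (raise F) a c - (coroot_wt a + coroot_wt c) *: F a c.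
Proof.
have raise1D (G H : node -> V) x :
  raise1 (fun y => G y + H y) x = raise1 G x + raise1 H x.
  by rewrite /raise1; do 2!case: ifP => _; rewrite ?add0r ?addr0 // addrACA.
have shift1D (G H : node -> V) x :
  shift1 (fun y => G y + H y) x = shift1 G x + shift1 H x.
  by rewrite /shift1 big_split.
have cross (G : node -> node -> V) x y :
  raise1 (fun z => shift1 (G z) y) x = shift1 (fun z => raise1 (G^~ z) x) y.
  rewrite /raise1 /shift1 big_split /=.
  by do 2!case: ifP => _; rewrite ?big1_eq.
have -> : shift (raise F) a c =
    (shift1 (raise1 (F^~ c)) a + shift1 (fun y => raise1 (F y) c) a) +
    (shift1 (fun y => raise1 (F^~ y) a) c + shift1 (raise1 (F a)) c).
  by rewrite /shift -!shift1D.
rewrite /raise /shift !raise1D.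
rewrite [raise1 (fun=> shift1 (F^~ c) _) a]raise1_shift1.
rewrite [raise1 (fun=> shift1 (F a) _) c]raise1_shift1.
rewrite (cross F a c) (cross (fun x y => F y x) c a) scalerDl opprD.
rewrite [LHS](AC (3*(1*2)) ((1*4)*(3*5)*(2*6)))%AC.
by [].
Qed.

End RaisingAction.

End SimpleRoot.

End Nodes.

(** * The action of the nilpotent subalgebra on differential polynomials *)

Section NilpotentAction.

Variables (K : fieldType) (n : nat) (A : comAlgType K).
Variables (var : 'I_n * nat -> A) (dvar : 'I_n * nat -> A -> A).
Variables (ev : ('I_n * nat -> A) -> A -> A).
Variables (vf : ('I_n * nat -> A) -> A -> A) (deg : A -> nat).
Hypothesis PM : polynomial_model var dvar ev vf deg.

Variable T : A -> A.
Hypothesis derT : derivation T.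
Hypothesis T_var : forall i r, T (var (i, r)) = r.+1%:R * var (i, r.+1).

Local Notation node := ('I_n * bool)%type.
Local Notation jet := (jet var T).

Definition weight (a : node) : A := (-1) ^+ a.2 *: var (a.1, 0%N).

Lemma weight_dual a : weight (dual a) = - weight a.
Proof. by rewrite /weight signrN scaleNr. Qed.

(** The action of the Lie algebra of n on jets is that of infinitesimal gauge
    transformations of the connection d - p - u.  If g solves g' = [p + u, g] with
    initial value a root vector, then u varies by minus the Cartan part of
    [p, g]; a jet of u of higher level sees the derivatives of g, in which u
    contributes the weight and p contributes [shift]. *)
Fixpoint pair_jet (r : nat) (l : 'I_n) (a b : node) : A :=
  if pos a b then
    match r with
    | 0 => (shift (fun c d => - cartan K l c d) a b)%:A
    | r.+1 => T (pair_jet r l a b) + (weight a + weight b) * pair_jet r l a b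
              + shift (pair_jet r l) a b
    end
  else 0.

Definition pair_der (a b : node) : A -> A :=
  vf (fun x => x.2`!%:R^-1 *: pair_jet x.2 x.1 a b).

Lemma derivation_pair_der a b : derivation (pair_der a b).
Proof. exact: (pm_vf_der PM). Qed.

Lemma pair_der_jet a b l r : pair_der a b (jet l r) = pair_jet r l a b.
Proof.
rewrite (jetE derT T_var) (drvZ (derivation_pair_der a b)) /pair_der (pm_vf_var PM) /= scalerA.
by rewrite mulfV ?scale1r ?(fact_neq0 PM).
Qed.

Lemma pair_der_npos a b P : ~~ pos a b -> pair_der a b P = 0.
Proof.
move=> npos; apply: (derivation_jet_eq0 PM derT T_var (derivation_pair_der a b)) => l r.
by rewrite pair_der_jet; case: r => [|r] /=; rewrite (negPf npos).
Qed.

Lemma derivation_shift (F : node -> node -> A -> A) a b :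
  (forall c d, derivation (F c d)) ->
  derivation (fun P => shift (fun c d => F c d P) a b).
Proof. by move=> dF; apply: derivation_add; apply: derivation_sum. Qed.

Lemma pair_der_T a b P : pos a b ->
  pair_der a b (T P) = T (pair_der a b P) + (weight a + weight b) * pair_der a b P
                  + shift (fun c d => pair_der c d P) a b.
Proof.
move=> pab; apply/eqP; rewrite -addrA addrC -subr_eq; apply/eqP; move: P.
apply: (eq_derivation_jet PM derT T_var).
- exact: (derivation_comm (derivation_pair_der a b) derT).
- apply: derivation_add; first exact: (derivation_mul _ (derivation_pair_der a b)).
  by apply: derivation_shift => c d; exact: derivation_pair_der.
move=> l r; rewrite -jetS !pair_der_jet /= pab [LHS]addrC addrA addKr.
by congr (_ + _); apply: shift_ext => c d; rewrite pair_der_jet.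
Qed.

Lemma pair_der_antisym a b P : pair_der b a P = - pair_der a b P.
Proof.
apply/eqP; rewrite -subr_eq0 opprK; apply/eqP; move: P.
apply: (derivation_jet_eq0 PM derT T_var).
  exact: (derivation_add (derivation_pair_der b a) (derivation_pair_der a b)).
move=> l r; rewrite !pair_der_jet; apply/eqP; rewrite addr_eq0; apply/eqP.
elim: r a b => [|r IHr] a b /=; rewrite posC; case: ifP => _; rewrite ?oppr0 //.
  rewrite -scaleNr -shift_antisym // => c d.
  by rewrite cartan_antisym.
rewrite IHr (shift_antisym (IHr)) (drvN derT) mulrN [weight b + _]addrC.
by rewrite -!opprD.
Qed.

Section Root.

Variables (i j : 'I_n) (b : bool).
Hypothesis depth_j : depth (j, b) = i.+1.
Hypothesis i_lt : (i.+1 < n)%N.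

Local Notation h := (coroot K i j b).
Local Notation hwt := (coroot_wt K i j b).
Local Notation raise := (raise i j b).

Definition root_form : A := weight (i, false) - weight (j, b).

Variable V : A -> A.
Hypothesis derV : derivation V.
Hypothesis V_var : forall l, V (var (l, 0%N)) = (h l)%:A.
Hypothesis V_T : forall P, V (T P) = T (V P) + root_form * V P.

Lemma V_weight a : V (weight a) = (hwt a)%:A.
Proof. by rewrite /weight (drvZ derV) V_var scalerA. Qed.

Definition cartan_root (a c : node) : K :=
  if c == dual a then (-1) ^+ a.1 * hwt a else 0.

Lemma cartan_rootE a c :
  cartan_root a c = cartan K i a c - (-1) ^+ b * cartan K j a c.
Proof.
rewrite /cartan_root /cartan; case: ifP => _; last by rewrite mulr0 subr0.
rewrite /coroot_wt /coroot /wt /= !(eq_sym _ a.1).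
by case: eqP => _; case: eqP => _; rewrite ?mulr0n ?mulr1n; ring.
Qed.

Lemma pair_der_root a c : pos a c ->
  pair_der a c root_form = (shift (fun x y => - cartan_root x y) a c)%:A.
Proof.
move=> pac; have nv l : pair_der a c (var (l, 0%N)) =
    (shift (fun x y => - cartan K l x y) a c)%:A.
  by have := pair_der_jet a c l 0; rewrite /= pac.
rewrite /root_form /weight (drvB (derivation_pair_der a c)) !(drvZ (derivation_pair_der a c)) !nv /=.
rewrite scale1r scalerA -scalerBl; congr (_ *: _).
have -> : shift (fun x y => - cartan_root x y) a c =
    shift (fun x y => - cartan K i x y + (-1) ^+ b * cartan K j x y) a c.
  by apply: shift_ext => x y; rewrite cartan_rootE opprB addrC.
rewrite shiftD; congr (_ + _).
have mulD (u v : K) : - (-1) ^+ b * (u + v) = - (-1) ^+ b * u + - (-1) ^+ b * v.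
  exact: mulrDr.
rewrite -mulNr (shift_morph _ a c mulD (mulr0 _)).
by apply: shift_ext => x y; rewrite mulrNN.
Qed.

Lemma sign_j : (-1) ^+ j = - (-1) ^+ i :> K.
Proof.
rewrite -signr_odd -[in RHS]signr_odd -signrN; congr (_ ^+ (nat_of_bool _)).
have : odd (depth (j, b)) = odd i.+1 by rewrite depth_j.
rewrite /depth /= => <-; case: (b) => //=.
by rewrite oddB ?odd_double //; have := ltn_ord j; lia.
Qed.

Lemma simple_pos : pos (i, false) (j, ~~ b).
Proof. by rewrite /pos (depth_dual_j depth_j) /depth /=; lia. Qed.

Lemma shift_simple (U : zmodType) (F : node -> node -> U) :
  (depth (j, b) = n.-1 -> F (j, ~~ b) (j, ~~ b) = 0) ->
  shift F (i, false) (j, ~~ b) = F (j, b) (j, ~~ b) + F (i, false) (i, true).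
Proof.
move=> F0; rewrite /shift /shift1 -(depth_i_true depth_j i_lt).
rewrite {1}/depth /= -depth_j !sum_depth /dual /=.
case: eqP => [/F0 ->|_]; rewrite ?addr0; congr (_ + _).
all: have -> : (depth (i, true) == n.-1) = false; last by rewrite addr0.
all: by apply/negbTE; rewrite /depth /=; lia.
Qed.

(** Both sides satisfy the same commutation rule with T, because the principal
    nilpotent element maps a simple root vector into the Cartan subalgebra, and
    they agree on the jets of level zero. *)
Lemma pair_der_simple P : pair_der (i, false) (j, ~~ b) P = - ((-1) ^+ i *: V P).
Proof.
move: P; apply: (eq_derivation_jet PM derT T_var).
- exact: derivation_pair_der.
- exact/derivation_opp/derivation_scale.
move=> l; elim=> [|r IHr].
  rewrite pair_der_jet /= simple_pos V_var scalerA -scaleNr; congr (_ *: _).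
  rewrite shift_simple => [|_]; last first.
    by rewrite /cartan eq_sym dual_neq oppr0.
  rewrite /cartan /dual /= !eqxx sign_j /coroot; ring.
rewrite jetS pair_der_T ?simple_pos // IHr V_T.
have -> : weight (j, ~~ b) = - weight (j, b) by rewrite -weight_dual.
rewrite shift_simple => [|dj].
  rewrite !pair_der_npos ?addr0; first last.
  - by rewrite /pos (depth_dual (j, b)) ltnn.
  - by rewrite /pos (depth_dual (i, false)) ltnn.
  by rewrite (drvN derT) (drvZ derT) scalerDr mulrN opprD scalerAr.
by apply: pair_der_npos; have := depth_dual (j, b); rewrite /pos /dual dj /=; lia.
Qed.

Let F (P : A) (x y : node) : A := pair_der x y P.

(** The summand with [cartan_root] occurs for pairs of weight zero: the simple root
    vector maps an element x of the Cartan subalgebra to - alpha(x) times itself. *)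
Lemma raise_pair_der a c P : raise (F P) a c =
  (if pos a c then raise (F P) a c else 0) - cartan_root a c *: V P.
Proof.
have off (dac : (depth a + depth c)%N != (n.-1).*2) : cartan_root a c = 0.
  rewrite /cartan_root; case: eqP => // ca.
  by move: dac; rewrite ca depth_dual eqxx.
case: ifP => pac.
  by rewrite off ?scale0r ?subr0 // neq_ltn; apply/orP; left.
rewrite sub0r; case: (ltngtP (depth a + depth c)%N (n.-1).*2) => dac.
- by move: pac; rewrite /pos dac.
- rewrite off ?gtn_eqF // scale0r oppr0 /raise /raise1 /F.
  have e1 := depth_i_true depth_j i_lt.
  have ei : depth (i, false) = i by [].
  do 4!case: eqP => [/(congr1 (@depth n))?|_]; rewrite ?pair_der_npos ?addr0 //;
    by rewrite /pos; lia.
have : (c == dual a) || (c == a).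
  have -> : (c == a) = (dual c == dual a).
    by apply/eqP/eqP => [->|/(congr1 (@dual n))]; rewrite ?dualK.
  have := depth_eq (dual a) c; have -> : (depth c == depth (dual a)).
    by have := depth_dual a; lia.
  by move/esym/orP => [->//|/andP[_]]; rewrite dualK => /eqP->; rewrite eqxx orbT.
move=> /orP[/eqP ca|/eqP->]; last first.
  have anti (x : node) : F P x a = - F P a x by rewrite /F pair_der_antisym.
  rewrite /raise {1}/raise1 !anti /raise1 /cartan_root [a == dual a]eq_sym dual_neq scale0r oppr0.
  by do 2!case: ifP => _; rewrite ?addr0 ?add0r ?oppr0 ?addr0 ?addNr // addrACA !addNr addr0.
have X := pair_der_simple P; set VP := V P in X *.
have X' : pair_der (j, ~~ b) (i, false) P = (-1) ^+ i *: VP by rewrite pair_der_antisym X opprK.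
have ij := simple_neq depth_j i_lt.
rewrite ca /raise /raise1 /F /cartan_root eqxx (coroot_wt_cases K depth_j i_lt).
case: a {pac dac off ca} => x s; rewrite /dual /= !xpair_eqE.
have [->|xi] := eqVneq x i.
  rewrite (negPf ij) /=; case: (s) => /=; rewrite ?X ?X' !addr0 ?add0r.
    by rewrite !oppr0 addr0 mulrN1 scaleNr opprK.
  by rewrite !oppr0 !addr0 mulr1.
have [->|xj] /= := eqVneq x j; last by rewrite !subr0 mulr0 scale0r oppr0 !addr0.
rewrite sign_j.
case: (s); case: (b) X X' => /= X X'; rewrite ?X ?X' ?oppr0 ?addr0 ?add0r;
  by rewrite ?opprK ?mulr1 ?mulrN1 ?mulNr ?opprK ?scaleNr ?opprK.
Qed.

Lemma raise_pair_der_T a c P : pos a c ->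
  raise (F (T P)) a c = T (raise (F P) a c) +
    (root_form + (weight a + weight c)) * raise (F P) a c + raise (shift (F P)) a c.
Proof.
move=> pac; have T0 := drv0 derT.
have wj : weight (i, false) = root_form + weight (j, b) by rewrite /root_form subrK.
have wi : weight (j, ~~ b) = root_form + weight (i, true).
  by rewrite /root_form (weight_dual (j, b)) (weight_dual (i, false)) addrAC subrr add0r.
have e1 := depth_i_true depth_j i_lt.
have ei : depth (i, false) = i by [].
have nT x y : pos x y -> F (T P) x y =
    T (F P x y) + (weight x + weight y) * F P x y + shift (F P) x y.
  exact: pair_der_T.
have r1 x y : pos x y -> raise1 i j b ((F (T P))^~ y) x =
    T (raise1 i j b ((F P)^~ y) x) +
    (root_form + (weight x + weight y)) * raise1 i j b ((F P)^~ y) x +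
    raise1 i j b ((shift (F P))^~ y) x.
  move=> pxy; rewrite /raise1; case: eqP => [ex|_]; case: eqP => [ex'|_].
  - by have := simple_neq depth_j i_lt; move: ex'; rewrite ex => -[-> _]; rewrite eqxx.
  - rewrite !addr0 nT; last by move: pxy; rewrite ex /pos ei depth_j; lia.
    by rewrite ex wj [root_form + (_ + _)]addrA.
  - rewrite !add0r nT; last by move: pxy; rewrite ex' /pos e1; lia.
    by rewrite ex' wi [root_form + (_ + _)]addrA.
  - by rewrite !addr0 T0 mulr0 !addr0.
have anti x y Q : F Q x y = - F Q y x by rewrite /F pair_der_antisym.
have r2 x y : pos x y -> raise1 i j b (F (T P) x) y =
    T (raise1 i j b (F P x) y) +
    (root_form + (weight x + weight y)) * raise1 i j b (F P x) y +
    raise1 i j b (shift (F P) x) y.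
  move=> pxy; rewrite /raise1; case: eqP => [ey|_]; case: eqP => [ey'|_].
  - by have := simple_neq depth_j i_lt; move: ey'; rewrite ey => -[-> _]; rewrite eqxx.
  - rewrite !addr0 nT; last by move: pxy; rewrite ey /pos ei depth_j; lia.
    by rewrite ey wj [root_form + (_ + _)]addrCA.
  - rewrite !add0r nT; last by move: pxy; rewrite ey' /pos e1; lia.
    by rewrite ey' wi [root_form + (_ + _)]addrCA.
  - by rewrite !addr0 T0 mulr0 !addr0.
rewrite /raise r1 // r2 //.
move: (raise1 i j b ((F P)^~ c) a) (raise1 i j b (F P a) c) => u v.
rewrite (drvD derT u v) (mulrDr _ u v).
by rewrite [LHS](AC (3*3) ((1*4)*(2*5)*(3*6)))%AC.
Qed.

Lemma derivation_raise (G : node -> node -> A -> A) a c :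
  (forall x y, derivation (G x y)) ->
  derivation (fun P => raise (fun x y => G x y P) a c).
Proof.
move=> dG; rewrite /raise /raise1.
have dif (p : bool) D : derivation D -> derivation (fun P : A => if p then D P else 0).
  by case: p => // _; exact: derivation0.
by apply: derivation_add; apply: derivation_add; apply: dif.
Qed.

Let defect a c P : A :=
  if pos a c then V (pair_der a c P) - pair_der a c (V P) + raise (F P) a c else 0.

Let defect_der a c : derivation (defect a c).
Proof.
rewrite /defect; case: (pos a c); last exact: derivation0.
apply: derivation_add; first exact: (derivation_comm derV (derivation_pair_der a c)).
by apply: derivation_raise => x y; exact: derivation_pair_der.
Qed.

Let defect_T a c P : pos a c -> defect a c (T P) =
  T (defect a c P) + (root_form + (weight a + weight c)) * defect a c P +
  shift (fun x y => defect x y P) a c.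
Proof.
move=> pac; have dac := derivation_pair_der a c.
have VD := drvD derV; have ND := drvD dac.
have Vsh : V (shift (F P) a c) = shift (fun x y => V (pair_der x y P)) a c.
  by rewrite (shift_morph _ _ _ (drvD derV) (drv0 derV)).
have shdef : shift (fun x y => defect x y P) a c =
    V (shift (F P) a c) - shift (fun x y => pair_der x y (V P)) a c +
    shift (raise (F P)) a c + shift cartan_root a c *: V P.
  rewrite Vsh -shift_scale (shift_morph _ _ _ (@opprD A) (oppr0 A)) -!shiftD.
  apply: shift_ext => x y; rewrite [raise (F P) x y]raise_pair_der /defect.
  case: ifP => [_|npos]; first by rewrite -[RHS]addrA subrK.
  rewrite !pair_der_npos ?npos // (drv0 derV). by rewrite subr0 !add0r addNr.
have eV : V (pair_der a c (T P)) = T (V (pair_der a c P)) + root_form * V (pair_der a c P)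
    + (hwt a + hwt c)%:A * pair_der a c P
    + (weight a + weight c) * V (pair_der a c P) + V (shift (F P) a c).
  rewrite pair_der_T // [LHS]VD [V (_ + _ * _)]VD V_T (drvM derV) [V (weight a + _)]VD.
  by rewrite !V_weight -scalerDl addrA.
have eN : pair_der a c (V (T P)) = T (pair_der a c (V P))
    + (weight a + weight c) * pair_der a c (V P)
    + shift (fun x y => pair_der x y (V P)) a c
    + (- shift cartan_root a c)%:A * V P + root_form * pair_der a c (V P).
  rewrite V_T [LHS]ND pair_der_T // (drvM dac) pair_der_root //.
  by rewrite -(shift_morph _ _ _ (@opprD K) (oppr0 K)) addrA.
have eR := raise_pair_der_T P pac.
rewrite (raise_shift depth_j i_lt) -/(F P a c) -mulr_algl in eR.
rewrite /defect pac shdef eV eN eR -[_ *: V P]mulr_algl scaleNr.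
have -> : T (V (pair_der a c P) - pair_der a c (V P) + raise (F P) a c) =
    T (V (pair_der a c P)) - T (pair_der a c (V P)) + T (raise (F P) a c).
  by rewrite [LHS](drvD derT) (drvB derT (V _)).
have -> : F P a c = pair_der a c P by [].
ring.
Qed.

(** Both sides obey the same commutation rule with T and agree on the jets of
    level zero; the commutation rules match by [raise_shift] and
    [raise_pair_der]. *)
Lemma pair_der_bracket a c P : pos a c ->
  V (pair_der a c P) = pair_der a c (V P) - raise (fun x y => pair_der x y P) a c.
Proof.
move=> pac; suff : defect a c P = 0.
  rewrite /defect pac => /eqP; rewrite addr_eq0 subr_eq => /eqP->.
  by rewrite addrC.
clear pac; move: a c P.
suff jet0 r l a c : defect a c (jet l r) = 0.
  by move=> a c P; exact: (derivation_jet_eq0 PM derT T_var (defect_der a c)).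
elim: r a c => [|r IHr] a c; last first.
  case pac: (pos a c); last by rewrite /defect pac.
  rewrite jetS defect_T // IHr (drv0 derT) mulr0 !add0r.
  by rewrite /shift /shift1 !big1 ?addr0.
rewrite /defect; case: ifP => // pac.
rewrite V_var (drv_alg (derivation_pair_der a c)) pair_der_jet /= pac (drv_alg derV) subr0 add0r.
have cart0 (x y : node) : pos x y ->
    (forall z t : node, (depth z + depth t)%N = (depth x + depth y).+1 ->
      cartan K l z t = 0) -> F (jet l 0) x y = 0.
  move=> pxy H; rewrite /F pair_der_jet /= pxy.
  rewrite (shift_ext_at (G := fun _ _ => 0)) ?shift0 ?scale0r //.
  by move=> z t zt; rewrite H ?oppr0.
have e1 := depth_i_true depth_j i_lt.
have ei : depth (i, false) = i by [].
have z0 (x y : node) : (depth x + depth y).+1 = (depth a + depth c)%N -> F (jet l 0) x y = 0.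
  move=> dxy; apply: cart0; first by move: pac; rewrite /pos; lia.
  by move=> z t zt; apply: cartan_depth; move: pac; rewrite /pos; lia.
rewrite /raise /raise1.
by do 4!case: eqP => [/(congr1 (@depth n))?|_]; rewrite ?z0 ?addr0 //; lia.
Qed.

End Root.

End NilpotentAction.

(** * The whole nilpotent subalgebra annihilates the W-algebra *)

Section Annihilation.

Variables (K : fieldType) (n : nat) (A : comAlgType K).
Variables (var : 'I_n * nat -> A) (dvar : 'I_n * nat -> A -> A).
Variables (ev : ('I_n * nat -> A) -> A -> A).
Variables (vf : ('I_n * nat -> A) -> A -> A) (deg : A -> nat).
Hypothesis PM : polynomial_model var dvar ev vf deg.

Variable T : A -> A.
Hypothesis derT : derivation T.
Hypothesis T_var : forall i r, T (var (i, r)) = r.+1%:R * var (i, r.+1).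

Local Notation node := ('I_n * bool)%type.
Local Notation jet := (jet var T).
Local Notation pair_der := (pair_der var vf T).

(** The roots eps_i - eps_{i+1} (b = false) and eps_{n-1} + eps_n (b = true): their root
    vectors map the basis vector at (j, b) to the one at (i, false). *)
Definition simple_root (i j : 'I_n) (b : bool) : Prop :=
  depth (j, b) = i.+1 /\ (i.+1 < n)%N.

Definition root_operator (i j : 'I_n) (b : bool) (V : A -> A) : Prop :=
  [/\ derivation V, forall l, V (var (l, 0%N)) = (coroot K i j b l)%:A
    & forall P, V (T P) = T (V P) + root_form var i j b * V P].

Variable screen : 'I_n -> 'I_n -> bool -> A -> A.
Hypothesis screenP :
  forall i j b, simple_root i j b -> root_operator i j b (screen i j b).

Variable P : A.
Hypothesis screen_P : forall i j b, simple_root i j b -> screen i j b P = 0.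

Let pair_der_simple0 i j b : simple_root i j b -> pair_der (i, false) (j, ~~ b) P = 0.
Proof.
move=> ijb; have [derV Vvar VT] := screenP ijb; have [dj ni] := ijb.
by rewrite (pair_der_simple PM derT T_var dj ni derV Vvar VT) screen_P // scaler0 oppr0.
Qed.

Let raise_eq0 i j b a c : simple_root i j b -> pos a c -> pair_der a c P = 0 ->
  raise i j b (fun x y => pair_der x y P) a c = 0.
Proof.
move=> ijb pac N0; have [derV Vvar VT] := screenP ijb; have [dj ni] := ijb.
have := pair_der_bracket PM derT T_var dj ni derV Vvar VT P pac.
rewrite N0 screen_P // (drv0 derV) (drv0 (derivation_pair_der PM T a c)) sub0r.
by move/esym/eqP; rewrite oppr_eq0 => /eqP.
Qed.

Let simple_succ (x z : 'I_n) : z = x.+1 :> nat -> simple_root x z false.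
Proof. by move=> zx; split; [rewrite /depth /= zx|rewrite -zx; exact: ltn_ord]. Qed.

Let pair_der_ft (d : nat) (x y : 'I_n) : y = (x + d.+1)%N :> nat ->
  pair_der (x, false) (y, true) P = 0.
Proof.
elim: d x => [|d IHd] x yx.
  by apply: (pair_der_simple0 (b := false)); apply: simple_succ; rewrite yx addn1.
have zn : (x.+1 < n)%N by have := ltn_ord y; lia.
pose z := Ordinal zn.
have yz : y = (z + d.+1)%N :> nat by rewrite yx /= addSnnS.
have := raise_eq0 (simple_succ (erefl : z = x.+1 :> nat)) _ (IHd z yz).
rewrite /raise /raise1 !xpair_eqE !eqxx -!val_eqE /=.
rewrite (_ : (y == x :> nat) = false) ?addr0; last by apply/negbTE; lia.
rewrite ?andbF ?andbT /= ?addr0; apply.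
by rewrite /pos /depth /=; have := ltn_ord y; lia.
Qed.

Let pair_der_fm (d : nat) (x y : 'I_n) : y = (x + d.+1)%N :> nat -> y.+1 = n ->
  pair_der (x, false) (y, false) P = 0.
Proof.
elim: d x => [|d IHd] x yx ym.
  apply: (pair_der_simple0 (b := true)); split; last by lia.
  by rewrite /depth /=; lia.
have zn : (x.+1 < n)%N by have := ltn_ord y; lia.
pose z := Ordinal zn.
have yz : y = (z + d.+1)%N :> nat by rewrite yx /= addSnnS.
have := raise_eq0 (simple_succ (erefl : z = x.+1 :> nat)) _ (IHd z yz ym).
rewrite /raise /raise1 !xpair_eqE !eqxx -!val_eqE /=.
rewrite (_ : (y == x.+1 :> nat) = false); last by apply/negbTE; lia.
rewrite ?andbF ?andbT /= ?addr0; apply.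
by rewrite /pos /depth /=; lia.
Qed.

Let pair_der_ff (d : nat) (x y : 'I_n) : (x < y)%N -> n = (y + d.+1)%N ->
  pair_der (x, false) (y, false) P = 0.
Proof.
elim: d y => [|d IHd] y xy ny.
  by apply: (@pair_der_fm (y - x.+1)%N); lia.
have zn : (y.+1 < n)%N by lia.
pose z := Ordinal zn.
have xz : (x < z)%N by rewrite /= ltnW.
have nz : n = (z + d.+1)%N by rewrite [LHS]ny /= addSnnS.
have := raise_eq0 (simple_succ (erefl : z = y.+1 :> nat)) _ (IHd z xz nz).
rewrite /raise /raise1 !xpair_eqE !eqxx -!val_eqE /=.
rewrite (_ : (x == y.+1 :> nat) = false); last by apply/negbTE; lia.
rewrite ?andbF ?andbT /= ?addr0 ?add0r; apply.
by rewrite /pos /depth /=; lia.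
Qed.

(** Every positive root vector is obtained from a simple one by successive
    brackets with simple root vectors. *)
Lemma pair_der_eq0 a c : pair_der a c P = 0.
Proof.
case pac: (pos a c); last by apply: (pair_der_npos PM derT T_var); rewrite pac.
have anti := pair_der_antisym PM derT T_var.
have ff (x y : 'I_n) : (x < y)%N -> pair_der (x, false) (y, false) P = 0.
  by move=> xy; apply: (@pair_der_ff (n - y.+1)%N) => //; have := ltn_ord y; lia.
have ft (x y : 'I_n) : (x < y)%N -> pair_der (x, false) (y, true) P = 0.
  by move=> xy; apply: (@pair_der_ft (y - x.+1)%N); lia.
case: a c pac => [x [] ] [y []]; rewrite /pos /depth /= => pac.
- by have := ltn_ord x; have := ltn_ord y; lia.
- by rewrite anti ft ?oppr0 //; have := ltn_ord x; have := ltn_ord y; lia.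
- by rewrite ft //; have := ltn_ord x; have := ltn_ord y; lia.
case: (ltngtP x y) => [xy|yx|xy]; first exact: ff.
  by rewrite anti ff ?oppr0.
rewrite (val_inj xy); apply/eqP; have := anti (y, false) (y, false) P.
move/eqP; rewrite -addr_eq0 -mulr2n -scaler_nat scaler_eq0.
by rewrite (negPf (pm_char PM 1)).
Qed.

End Annihilation.

(** * Evaluation along the principal chain *)

Section Levels.

Variables (n : nat).

Local Notation node := ('I_n * bool)%type.
Local Notation top := (n.-1).*2.

(** Both vectors of depth n - 1 are mapped to the vector of depth n, hence the
    factor 2 from there on. *)
Definition level_mult (s : nat) : nat := if (s < n)%N then 1 else 2.

(** Up to the factor [level_mult], the sum of the basis vectors at the nodes of
    depth s is the image of the highest weight vector under the s-th power of the
    principal nilpotent element. *)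
Definition level (V : zmodType) (F : node -> V) (s : nat) : V :=
  (\sum_(a | depth a == s) F a) *+ level_mult s.

Definition level2 (V : zmodType) (F : node -> node -> V) (s t : nat) : V :=
  level (fun a => level (F a) t) s.

Definition step (V : zmodType) (G : nat -> nat -> V) (s t : nat) : V :=
  G s.+1 t + G s t.+1.

Lemma depth_surj s : (0 < n)%N -> (s <= top)%N -> exists a : node, depth a = s.
Proof.
move=> n0 st; case: (ltnP s n) => sn; first by exists (Ordinal sn, false).
have sn' : (top - s < n)%N by lia.
by exists (Ordinal sn', true); rewrite /depth /=; lia.
Qed.

Section LevelTheory.

Variable V : zmodType.

Lemma level_shift1 (F : node -> V) s : (0 < n)%N ->
  level (shift1 F) s = level F s.+1.
Proof.
move=> n0; rewrite /level /shift1.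
set X := \sum_(c | depth c == s.+1) F c.
have -> : \sum_(a : node | depth a == s) \sum_(c | depth c == (depth a).+1) F c =
          \sum_(a : node | depth a == s) X.
  by apply: eq_bigr => a /eqP->.
case: (leqP s top) => st; last first.
  have -> : X = 0.
    by rewrite /X big_pred0 // => c; have := depth_le c; case: eqP => // ->; lia.
  by rewrite big1_eq !mul0rn.
have [a <-] := depth_surj n0 st.
rewrite (sum_depth (fun=> X)) /level_mult; have := depth_le a.
case: (eqVneq (depth a) n.-1) => [->|ne] _.
  by rewrite ltn_predL n0 prednK // ltnn mulr1n mulr2n.
rewrite addr0; congr (_ *+ _); case: ltnP => h; case: ltnP => h' //; lia.
Qed.

Lemma eq_level (F G : node -> V) s :
  (forall a, depth a = s -> F a = G a) -> level F s = level G s.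
Proof. by move=> FG; congr (_ *+ _); apply: eq_bigr => a /eqP /FG. Qed.

Lemma levelD (F G : node -> V) s :
  level (fun a => F a + G a) s = level F s + level G s.
Proof. by rewrite /level big_split mulrnDl. Qed.

Lemma level0 s : level (fun=> 0 : V) s = 0.
Proof. by rewrite /level big1_eq mul0rn. Qed.

Lemma eq_level2 (F G : node -> node -> V) s t :
  (forall a c, depth a = s -> depth c = t -> F a c = G a c) ->
  level2 F s t = level2 G s t.
Proof.
by move=> FG; apply: eq_level => a da; apply: eq_level => c dc; apply: FG.
Qed.

Lemma level2_shift (F : node -> node -> V) s t : (0 < n)%N ->
  level2 (shift F) s t = step (level2 F) s t.
Proof.
move=> n0; rewrite /step /level2 /shift.
transitivity (level (fun a => level (fun c => shift1 (F^~ c) a) t) s +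
              level (fun a => level (shift1 (F a)) t) s).
  by rewrite -levelD; apply: eq_level => a _; rewrite -levelD.
congr (_ + _); last by apply: eq_level => a _; rewrite level_shift1.
rewrite -level_shift1 //; apply: eq_level => a _.
by rewrite /level /shift1 exchange_big /= -sumrMnl.
Qed.

Lemma level2_iter_shift (F : node -> node -> V) N s t : (0 < n)%N ->
  level2 (iter N (@shift n V) F) s t = iter N (@step V) (level2 F) s t.
Proof.
move=> n0; elim: N s t => [|N IHN] s t //=.
by rewrite level2_shift // /step !IHN.
Qed.

Lemma iter_shift0 N a c :
  iter N (@shift n V) (fun _ _ => 0 : V) a c = 0.
Proof.
elim: N a c => //= N IHN a c.
by rewrite (shift_ext (G := fun _ _ => 0)) ?shift0.
Qed.

End LevelTheory.

Lemma level_morph (V V' : zmodType) (f : V -> V') F s :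
  (forall x y, f (x + y) = f x + f y) -> f 0 = 0 ->
  f (level F s) = level (fun a => f (F a)) s.
Proof.
move=> fD f0; rewrite /level -(big_morph f fD f0).
by elim: (level_mult s) => [|m IHm]; rewrite ?mulr0n // !mulrS fD IHm.
Qed.

Lemma level2_morph (V V' : zmodType) (f : V -> V') F s t :
  (forall x y, f (x + y) = f x + f y) -> f 0 = 0 ->
  f (level2 F s t) = level2 (fun a c => f (F a c)) s t.
Proof.
move=> fD f0; rewrite /level2 (level_morph _ _ fD f0).
by apply: eq_level => a _; exact: level_morph.
Qed.

End Levels.

Section IteratedSteps.

Variable K : fieldType.

(** Passing to the next step takes the difference of G with respect to s up to
    sign, and a difference of binomial coefficients lowers the lower index. *)
Lemma iter_step_binomial (G : nat -> nat -> K) (k : K) (top p N : nat) :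
  (forall s t, (s + t)%N = top ->
    G s t = k * ((-1) ^+ s * ('C(s + p, p)%:R - 'C(t + p, p)%:R))) ->
  (N <= p)%N -> forall s t, (s + t + N)%N = top ->
  iter N (@step K) G s t =
    k * ((-1) ^+ (s + N) *
      ('C(s + p, p - N)%:R - (-1) ^+ N * 'C(t + p, p - N)%:R)).
Proof.
move=> GE; elim: N => [|N IHN] Np s t stN.
  by rewrite /= GE ?addn0 ?subn0 ?expr0 ?mul1r -?stN ?addn0.
rewrite /= /step !IHN ?(ltnW Np) //; try lia.
rewrite -(subnSK Np) !addSn !binS !natrD addnS !exprS; ring.
Qed.

Lemma iter_step_eq0 (G : nat -> nat -> K) (k : K) (top p N : nat) :
  (forall s t, (s + t)%N = top ->
    G s t = k * ((-1) ^+ s * ('C(s + p, p)%:R - 'C(t + p, p)%:R))) ->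
  (p < N)%N -> forall s t, (s + t + N)%N = top ->
  iter N (@step K) G s t = 0.
Proof.
move=> GE; elim: N => // N IHN; rewrite ltnS leq_eqVlt.
case/orP=> [/eqP <-|pN] s t stN.
  rewrite /= /step !(iter_step_binomial GE (leqnn p)) ?subnn ?bin0; try lia.
  by rewrite addSn exprS; ring.
by rewrite /= /step !IHN ?addr0 //; lia.
Qed.

End IteratedSteps.

(** * Pairing the root directions with the leading forms *)

Section Probes.

Variables (n : nat).

Local Notation node := ('I_n * bool)%type.
Local Notation top := (n.-1).*2.

(** The level of the leading jets of the k-th generator: the exponents
    1, 3, ..., 2n - 3 of the root system, and n - 1. *)
Definition exponent (k : 'I_n) : nat := if (k.+1 < n)%N then k.*2.+1 else n.-1.

Lemma exponent_le k : (exponent k <= top)%N.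
Proof. by rewrite /exponent; case: ltnP; lia. Qed.

Lemma iter_shift_morph (V V' : zmodType) (f : V -> V') N F a c :
  (forall x y, f (x + y) = f x + f y) -> f 0 = 0 ->
  f (iter N (@shift n V) F a c) = iter N (@shift n V') (fun x y => f (F x y)) a c.
Proof.
move=> fD f0; elim: N a c => //= N IHN a c.
by rewrite (shift_morph _ _ _ fD f0); apply: shift_ext => x y; exact: IHN.
Qed.

Lemma iter_shift_ext_at (V : zmodType) N (F G : node -> node -> V) a c :
  (forall x y, (depth x + depth y)%N = (depth a + depth c + N)%N -> F x y = G x y) ->
  iter N (@shift n V) F a c = iter N (@shift n V) G a c.
Proof.
elim: N a c => [|N IHN] a c FG /=; first by apply: FG; rewrite addn0.
apply: shift_ext_at => x y xy; apply: IHN => z t zt; apply: FG.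
by rewrite zt xy; lia.
Qed.

Variable last : 'I_n.
Hypothesis lastE : last.+1 = n.

Let n_gt0 : (0 < n)%N. Proof. by rewrite -lastE. Qed.

(** Evaluation at a vector of height [exponent k] of the exterior square.  With w_s
    the s-th image of the highest weight vector under the principal nilpotent
    element, it is the product of w_0 and w_(top - exponent k), except for the
    last index, where it is the product of w_0 with the difference of the two
    vectors of depth n - 1, which the principal nilpotent element annihilates. *)
Definition probe (V : zmodType) (k : 'I_n) (F : node -> node -> V) : V :=
  if (k.+1 < n)%N then level2 F 0 (top - exponent k)
  else level (F (last, false)) 0 - level (F (last, true)) 0.

Lemma probe_ext (V : zmodType) k (F G : node -> node -> V) :
  (forall a c, (depth a + depth c + exponent k)%N = top -> F a c = G a c) ->
  probe k F = probe k G.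
Proof.
move=> FG; have ek := exponent_le k; rewrite /probe; case: ifP => kn.
  by apply: eq_level2 => a c a0 c0; apply: FG; rewrite a0 c0; lia.
have e : exponent k = n.-1 by rewrite /exponent kn.
by congr (_ - _); apply: eq_level => c c0; apply: FG;
  rewrite c0 e /depth /=; lia.
Qed.

Lemma probe_morph (V V' : zmodType) (f : V -> V') k F :
  (forall x y, f (x + y) = f x + f y) -> f 0 = 0 ->
  f (probe k F) = probe k (fun a c => f (F a c)).
Proof.
move=> fD f0; rewrite /probe; case: ifP => _; first exact: level2_morph.
have fN x : f (- x) = - f x by apply/eqP; rewrite -addr_eq0 -fD addNr f0.
by rewrite fD fN !(level_morph _ _ fD f0).
Qed.

Lemma probe0 (V : zmodType) k : probe k (fun _ _ => 0 : V) = 0.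
Proof.
by rewrite /probe /level2 !level0 subr0 if_same.
Qed.

Lemma last_row_shift (V : zmodType) N (F : node -> node -> V) t :
  level (iter N (@shift n V) F (last, false)) t -
    level (iter N (@shift n V) F (last, true)) t =
  level (F (last, false)) (t + N) - level (F (last, true)) (t + N).
Proof.
have step1 (G : node -> node -> V) s :
  level (shift G (last, false)) s - level (shift G (last, true)) s =
  level (G (last, false)) s.+1 - level (G (last, true)) s.+1.
  have eqd : depth (last, false) = depth (last, true) by rewrite /depth /=; lia.
  rewrite -!level_shift1 // /shift !levelD /shift1 eqd.
  by rewrite opprD addrACA subrr add0r.
elim: N F t => [|N IHN] F t; first by rewrite addn0.
by rewrite !iterSr IHN step1 addnS.
Qed.

End Probes.

Section ChainDerivations.

Variables (K : fieldType) (n : nat) (A : comAlgType K).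
Variables (var : 'I_n * nat -> A) (dvar : 'I_n * nat -> A -> A).
Variables (ev : ('I_n * nat -> A) -> A -> A).
Variables (vf : ('I_n * nat -> A) -> A -> A) (deg : A -> nat).
Hypothesis PM : polynomial_model var dvar ev vf deg.

Variable T : A -> A.
Hypothesis derT : derivation T.
Hypothesis T_var : forall i r, T (var (i, r)) = r.+1%:R * var (i, r.+1).

Variable last : 'I_n.
Hypothesis lastE : last.+1 = n.

Local Notation node := ('I_n * bool)%type.
Local Notation top := (n.-1).*2.
Local Notation jet := (jet var T).
Local Notation pair_der := (pair_der var vf T).
Local Notation probe_at := (probe last).

Let ncartan (l : 'I_n) (a c : node) : K := - cartan K l a c.

Lemma iter_cartan_depth N l a c : (depth a + depth c + N)%N != top ->
  iter N (@shift n K) (ncartan l) a c = 0.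
Proof.
move=> aN; rewrite (@iter_shift_ext_at n _ N _ (fun _ _ => 0)) ?iter_shift0 // => x y xy.
by rewrite /ncartan cartan_depth ?oppr0 // xy.
Qed.

Lemma pair_der_jet_const s a c l : (depth a + depth c + s < top)%N ->
  pair_der a c (jet l s) = (iter s.+1 (@shift n K) (ncartan l) a c)%:A.
Proof.
elim: s a c => [|s IHs] a c acs.
  by rewrite (pair_der_jet PM derT T_var) /= /pos -(addn0 (_ + _)%N) acs.
rewrite jetS (pair_der_T PM derT T_var); last by rewrite /pos; lia.
rewrite IHs; last by lia.
rewrite iter_cartan_depth; last by lia.
rewrite scale0r (drv0 derT) mulr0 !add0r iterS -shift_scale.
by apply: shift_ext_at => x y xy; rewrite IHs //; lia.
Qed.

Lemma iter_pair_der_jet m s a c l : (depth a + depth c + m + s < top)%N ->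
  iter m (@shift n A) (fun x y => pair_der x y (jet l s)) a c =
  (iter (m + s.+1) (@shift n K) (ncartan l) a c)%:A.
Proof.
move=> acms; rewrite iterD.
rewrite (iter_shift_morph m _ a c (fun x y => scalerDl (1 : A) x y) (scale0r _)).
apply: iter_shift_ext_at => x y xy; apply: pair_der_jet_const; lia.
Qed.

(** The derivations obtained from the probed vector by descending with the
    principal nilpotent element to height s.+1. *)
Definition chain_derivation (k : 'I_n) (s : nat) (P : A) : A :=
  probe_at k (iter (exponent k - s.+1) (@shift n A) (fun a c => pair_der a c P)).

Definition chain_direction (k l : 'I_n) : K :=
  probe_at k (iter (exponent k) (@shift n K) (ncartan l)).

Lemma derivation_chain k s : derivation (chain_derivation k s).
Proof.
have dlevel (G : node -> A -> A) t : (forall a, derivation (G a)) ->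
    derivation (fun P => level (G^~ P) t).
  move=> dG; rewrite /level; apply: derivation_ext
    (derivation_scale (level_mult n t)%:R (derivation_sum (index_enum _)
      (fun a => depth a == t) dG)) => P.
  exact: scaler_nat.
have dshift N (G : node -> node -> A -> A) :
    (forall a c, derivation (G a c)) -> forall a c,
    derivation (fun P => iter N (@shift n A) (fun x y => G x y P) a c).
  move=> dG; elim: N => [|N IHN] a c /=; first exact: dG.
  exact: derivation_shift.
rewrite /chain_derivation /probe; case: (k.+1 < n)%N.
  apply: (dlevel) => a; apply: (dlevel) => c; apply: (dshift) => x y.
  exact: (derivation_pair_der PM).
apply: derivation_sub; apply: (dlevel) => c; apply: (dshift) => x y;
  exact: (derivation_pair_der PM).
Qed.

Lemma chain_derivation_eq0 k s P : (forall a c, pair_der a c P = 0) ->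
  chain_derivation k s P = 0.
Proof.
move=> P0; rewrite /chain_derivation -[RHS](probe0 last _ k); apply: probe_ext => // a c _.
rewrite (@iter_shift_ext_at n _ _ _ (fun _ _ => 0)) ?iter_shift0 //.
Qed.

Lemma chain_derivation_jet_lt k s l r : (s < exponent k)%N -> (r < s)%N ->
  chain_derivation k s (jet l r) = 0.
Proof.
move=> sk rs; rewrite /chain_derivation -[RHS](probe0 last _ k).
apply: probe_ext => // a c ack; rewrite iter_pair_der_jet; last by lia.
by rewrite iter_cartan_depth ?scale0r //; lia.
Qed.

Lemma chain_derivation_jet k s l : (s < exponent k)%N ->
  chain_derivation k s (jet l s) = (chain_direction k l)%:A.
Proof.
move=> sk; rewrite /chain_direction.
rewrite (probe_morph _ k _ (fun x y => scalerDl (1 : A) x y) (scale0r _)).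
apply: probe_ext => // a c ack; rewrite iter_pair_der_jet; last by lia.
by rewrite subnK.
Qed.

(** The linear form by which the j-th generator is led: [half_paths_leads] and
    [neg_path_leads]. *)
Definition lead_form (j l : 'I_n) : K :=
  if (j.+1 < n)%N then
    'C(l + j.*2.+1, j.*2.+1)%:R - 'C(top - l + j.*2.+1, j.*2.+1)%:R
  else (-1) ^+ n.-1 *+ (l == last).

Let cartan_form (j : 'I_n) (a c : node) : K :=
  if c == dual a then - ((-1) ^+ a.1 * ((-1) ^+ a.2 * lead_form j a.1)) else 0.

Lemma pairingE j k : \sum_l lead_form j l * chain_direction k l =
  probe_at k (iter (exponent k) (@shift n K) (cartan_form j)).
Proof.
pose F (a c : node) : 'rV[K]_n := \row_l ncartan l a c.
pose f (x : 'rV[K]_n) := \sum_l lead_form j l * x 0 l.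
have fD x y : f (x + y) = f x + f y.
  by rewrite /f -big_split; apply: eq_bigr => l _; rewrite mxE mulrDr.
have f0 : f 0 = 0 by rewrite /f big1 // => l _; rewrite mxE mulr0.
transitivity (f (probe_at k (iter (exponent k) (@shift n _) F))).
  apply: eq_bigr => l _; congr (_ * _).
  pose g (x : 'rV[K]_n) := x 0 l.
  have gD x y : g (x + y) = g x + g y by rewrite /g mxE.
  have g0 : g 0 = 0 by rewrite /g mxE.
  rewrite -[RHS]/(g _) (probe_morph _ k _ gD g0); apply: probe_ext => // a c _.
  rewrite (iter_shift_morph _ _ _ _ gD g0); apply: iter_shift_ext_at => x y _.
  by rewrite /g mxE.
rewrite (probe_morph _ k _ fD f0); apply: probe_ext => // a c _.
rewrite (iter_shift_morph _ _ _ _ fD f0); apply: iter_shift_ext_at => x y _.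
rewrite /f /cartan_form; case: eqP => [->|ne]; last first.
  rewrite big1 // => l _; rewrite mxE /ncartan /cartan; case: eqP => // _.
  by rewrite oppr0 mulr0.
rewrite (bigD1 x.1) //= big1 => [|l lx]; last first.
  by rewrite mxE /ncartan /cartan /wt eqxx eq_sym (negPf lx) mulr0n mulr0 oppr0 mulr0.
rewrite mxE /ncartan /cartan /wt !eqxx mulr1n; ring.
Qed.

Lemma sign_depth (a : node) : (-1) ^+ a.1 = (-1) ^+ depth a :> K.
Proof.
rewrite -signr_odd -[RHS]signr_odd; congr (_ ^+ (nat_of_bool _)).
case: a => x [] //; rewrite /depth /= oddB ?odd_double //.
by have := ltn_ord x; lia.
Qed.

(** The coefficients of the leading form extend to a function on all depths that is
    odd under the reflection s <-> top - s, hence the uniform formula. *)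
Lemma level2_cartan_form (j : 'I_n) s t : (j.+1 < n)%N -> (s + t)%N = top ->
  level2 (cartan_form j) s t =
  - 2%:R * ((-1) ^+ s * ('C(s + j.*2.+1, j.*2.+1)%:R - 'C(t + j.*2.+1, j.*2.+1)%:R)).
Proof.
move=> jn st; set X := (-1) ^+ s * _.
have inner a : depth a = s -> level (cartan_form j a) t = - X *+ level_mult n t.
  move=> das; rewrite /level /cartan_form; congr (_ *+ _).
  rewrite (sum_if_eq (fun c => depth c == t)).
  have -> : depth (dual a) == t by have := depth_dual a; lia.
  rewrite sign_depth das; congr (- (_ * _)).
  rewrite /lead_form jn; move: das st; case: a => x [] /=; rewrite /depth /= => <- st.
    have -> : t = x by have := ltn_ord x; lia.
    rewrite expr1; ring.
  by rewrite (_ : t = (top - x)%N) ?expr0 ?mul1r //; lia.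
rewrite /level2 (eq_level inner) /level.
have n0 : (0 < n)%N by rewrite -lastE.
have [a das] : exists a : node, depth a = s by apply: depth_surj => //; lia.
rewrite -das sum_depth das /level_mult; case: eqP => [sm|/eqP sm].
  have -> : X = 0 by rewrite /X; have -> : t = s; [lia|rewrite subrr mulr0].
  by rewrite oppr0 !mul0rn addr0 mul0rn mulr0.
rewrite addr0 mulNr mulr_natl mulNrn.
by case: (ltnP s n) => sn; case: (ltnP t n) => tn; rewrite ?mulr1n ?mulNrn //; lia.
Qed.

Lemma pairing_chain (j k : 'I_n) : (j.+1 < n)%N -> (k.+1 < n)%N ->
  \sum_l lead_form j l * chain_direction k l =
  iter k.*2.+1 (@step K) (level2 (cartan_form j)) 0 (top - k.*2.+1)%N.
Proof.
move=> jn kn; rewrite pairingE /probe kn /exponent kn level2_iter_shift //.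
by rewrite -lastE.
Qed.

Lemma pairing_last (j k : 'I_n) : k.+1 = n ->
  \sum_l lead_form j l * chain_direction k l =
  - 2%:R * ((-1) ^+ last * lead_form j last).
Proof.
move=> kn; rewrite pairingE /probe /exponent kn ltnn last_row_shift // add0n.
have dl b : (depth (last, b) == n.-1) by rewrite /depth /=; case: b => /=; lia.
have lm : level_mult n n.-1 = 1%N by rewrite /level_mult; case: ltnP => //; lia.
rewrite /level lm /cartan_form !mulr1n.
rewrite !(sum_if_eq (fun c => depth c == n.-1)) /dual /= !dl; ring.
Qed.

(** The pairing is an iterated difference, of order the k-th exponent, of a
    polynomial function of degree the j-th exponent. *)
Lemma pairing_lt (j k : 'I_n) : (j < k)%N ->
  \sum_l lead_form j l * chain_direction k l = 0.
Proof.
move=> jk; have jn : (j.+1 < n)%N by have := ltn_ord k; lia.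
case: (ltnP k.+1 n) => kn.
  rewrite pairing_chain //.
  by apply: (iter_step_eq0 (fun s t => @level2_cartan_form j s t jn)); lia.
rewrite pairing_last; last by have := ltn_ord k; lia.
rewrite /lead_form jn (_ : (top - last)%N = last); last by lia.
by rewrite subrr !mulr0.
Qed.

Lemma pairing_diag (j : 'I_n) :
  \sum_l lead_form j l * chain_direction j l != 0.
Proof.
have n2 : 2%:R != 0 :> K := pm_char PM 1.
case: (ltnP j.+1 n) => jn.
  rewrite pairing_chain //.
  rewrite (iter_step_binomial (fun s t => @level2_cartan_form j s t jn)) //; last by lia.
  rewrite subnn !bin0 add0n -signr_odd /= odd_double /= expr1.
  have -> : -2%:R * (-1 * (1 - -1 * 1)) = 2%:R * 2%:R :> K by ring.
  by rewrite mulf_neq0.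
have jl : j = last by apply/ord_inj; have := ltn_ord j; lia.
rewrite pairing_last jl // /lead_form lastE ltnn eqxx mulr1n.
by rewrite !mulf_neq0 ?oppr_eq0 // signr_eq0.
Qed.

End ChainDerivations.

(** * Exponential series *)

Section ExponentialSeries.

Variables (K : fieldType) (A : comAlgType K).
Hypothesis charK : forall m : nat, m.+1%:R != 0 :> K.
Variable T : A -> A.
Hypothesis derT : derivation T.

Definition exp_series (a : nat -> A) (r : nat) : A :=
  \sum_(k < r.+1)
     (k`!%:R^-1 : K) *:
     ((\sum_(1 <= m < r.+1) ((m%:R^-1 : K) *: a m) *: 'X^m) ^+ k : {poly A})`_r.

Let coefwise (p : {poly A}) : {poly A} := \poly_(i < size p) T p`_i.

Let coef_coefwise p i : (coefwise p)`_i = T p`_i.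
Proof.
rewrite coef_poly; case: ltnP => // si.
by rewrite nth_default // (drv0 derT).
Qed.

Let coefwiseM p q : coefwise (p * q) = coefwise p * q + p * coefwise q.
Proof.
apply/polyP => i; rewrite coefD coef_coefwise !coefM (drv_sum derT) -big_split.
by apply: eq_bigr => j _; rewrite (drvM derT) !coef_coefwise.
Qed.

Let coefwiseX p k : coefwise (p ^+ k) = coefwise p * p ^+ k.-1 *+ k.
Proof.
elim: k => [|k IHk].
  apply/polyP => i; rewrite expr0 mulr0n coef_coefwise coefC coef0.
  by case: eqP => _; rewrite ?(drv1 derT) ?(drv0 derT).
rewrite exprS coefwiseM IHk; case: k {IHk} => [|k] /=.
  by rewrite mulr0n mulr0 addr0 expr0.
by rewrite mulrnAr mulrCA -exprS -mulrS.
Qed.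

Let coef_exp_lt (p : {poly A}) k r : p`_0 = 0 -> (r < k)%N -> (p ^+ k)`_r = 0.
Proof.
move=> p0; elim: k r => // k IHk r rk; rewrite exprS coefM big1 // => i _.
case: (posnP i) => [->|i0]; first by rewrite p0 mul0r.
by rewrite [X in _ * X]IHk ?mulr0 //; have := ltn_ord i; lia.
Qed.

Let coef_exp_eq (p q : {poly A}) k r : (forall i, (i <= r)%N -> p`_i = q`_i) ->
  (p ^+ k)`_r = (q ^+ k)`_r.
Proof.
move=> pq; have [N] := ubnP r; elim: k r pq N => [|k IHk] r pq N rN.
  by rewrite !expr0.
rewrite !exprS !coefM; apply: eq_bigr => i _.
rewrite pq; last by rewrite -ltnS.
by congr (_ * _); apply: (IHk _ _ r.+1) => [j jr|]; [apply: pq|]; lia.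
Qed.

Variable a : nat -> A.

Let S (N : nat) : {poly A} := \sum_(1 <= m < N.+1) ((m%:R^-1 : K) *: a m) *: 'X^m.

Let coef_S N i : (S N)`_i = if (0 < i <= N)%N then (i%:R^-1 : K) *: a i else 0.
Proof.
rewrite /S coef_sum; case: ifP => iN.
  rewrite (bigD1_seq i) ?iota_uniq ?mem_index_iota //= coefZ coefXn eqxx mulr1.
  by rewrite big1 ?addr0 // => m /negPf mi; rewrite coefZ coefXn eq_sym mi mulr0.
rewrite big_nat big1 // => m mN; rewrite coefZ coefXn.
by case: eqVneq => [im|]; rewrite ?mulr0 //; move: iN mN; rewrite -im ltnS => ->.
Qed.

Let exp_seriesE N r : (r <= N)%N ->
  exp_series a r = \sum_(k < N.+1) (k`!%:R^-1 : K) *: (S N ^+ k)`_r.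
Proof.
move=> rN; rewrite /exp_series -/(S r) (big_ord_widen N.+1 (fun k => (k`!%:R^-1 : K) *:
  ((S r) ^+ k)`_r)) // big_mkcond; apply: eq_bigr => k _.
have -> : (S N ^+ k)`_r = (S r ^+ k)`_r.
  apply: coef_exp_eq => i ir; rewrite !coef_S ir (leq_trans ir rN).
  by [].
by case: ltnP => // kr; rewrite coef_exp_lt ?scaler0 // coef_S.
Qed.

Lemma eq_exp_series a' : a =1 a' -> exp_series a =1 exp_series a'.
Proof.
move=> aa' r; apply: eq_bigr => k _; congr (_ *: _).
congr (nth _ (polyseq (_ ^+ _)) _).
by apply: eq_bigr => m _; rewrite aa'.
Qed.

Lemma exp_series0 : exp_series a 0 = 1.
Proof.
by rewrite /exp_series big_ord1 expr0 coef1 fact0 invr1 scale1r.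
Qed.

Hypothesis T_a : forall m, T (a m.+1) = m.+1%:R *: a m.+2.

(** With S the exponent, the coefficients of z^r in the identity
    (exp S)' = (S' - T S) exp S + T (exp S), where S' - T S = a 1. *)
Lemma exp_series_rec r :
  r.+1%:R *: exp_series a r.+1 = T (exp_series a r) + a 1 * exp_series a r.
Proof.
rewrite (@exp_seriesE r.+1 r.+1) // (@exp_seriesE r.+1 r) //; set s := S r.+1.
have coef_s' i : (i <= r)%N -> (s^`() - coefwise s)`_i = (a 1)%:P`_i.
  move=> ir; rewrite coefB coef_deriv coef_coefwise !coef_S coefC.
  rewrite (_ : (0 < i.+1 <= r.+1)%N); last by lia.
  rewrite -scaler_nat scalerA mulfV ?scale1r //.
  case: i ir => [|i] ir /=; first by rewrite (drv0 derT) subr0.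
  rewrite (_ : (i < r.+1)%N) ?(drvZ derT) ?T_a; last by lia.
  rewrite scalerA mulVf ?charK // scale1r subrr //.
have term k : (s ^+ k)`_r.+1 *+ r.+1 =
    T (s ^+ k)`_r + a 1 * (s ^+ k.-1)`_r *+ k.
  apply/eqP; rewrite addrC -subr_eq -coef_coefwise -coef_deriv -coefB.
  rewrite deriv_exp coefwiseX -mulrnBl -mulrBl coefMn; apply/eqP; congr (_ *+ _).
  rewrite -coefCM !coefM.
  by apply: eq_bigr => i _; rewrite coef_s' // -ltnS.
rewrite scaler_sumr (drv_sum derT).
under eq_bigr do rewrite scalerA mulrC -scalerA scaler_nat term scalerDr.
rewrite big_split /=; congr (_ + _).
  by apply: eq_bigr => k _; rewrite (drvZ derT).
rewrite big_ord_recl /= mulr0n scaler0 add0r.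
rewrite [in RHS]big_ord_recr /= coef_exp_lt //; last by rewrite /s coef_S.
rewrite scaler0 addr0 mulr_sumr; apply: eq_bigr => k _.
rewrite -scaler_nat scalerA -scalerAr; congr (_ *: _).
by rewrite /bump /= add1n factS natrM invfM mulrAC mulVf ?mul1r ?charK.
Qed.

End ExponentialSeries.

(** * The screening operators *)

Section Screening.

Variables (K : fieldType) (n : nat) (A : comAlgType K).
Variables (var : 'I_n * nat -> A) (dvar : 'I_n * nat -> A -> A).
Variables (ev : ('I_n * nat -> A) -> A -> A).
Variables (vf : ('I_n * nat -> A) -> A -> A) (deg : A -> nat).
Hypothesis PM : polynomial_model var dvar ev vf deg.

Variable T : A -> A.
Hypothesis derT : derivation T.
Hypothesis T_var : forall i r, T (var (i, r)) = r.+1%:R * var (i, r.+1).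

Definition screening_exponent (i j : 'I_n) (b : bool) (m : nat) : A :=
  var (i, m.-1) - (-1) ^+ b *: var (j, m.-1).

Definition screening (i j : 'I_n) (b : bool) : A -> A :=
  vf (fun x => coroot K i j b x.1 *:
               exp_series (screening_exponent i j b) x.2).

Lemma screening_root_operator i j b :
  root_operator var T i j b (screening i j b).
Proof.
have derV : derivation (screening i j b) := pm_vf_der PM _.
have Vvar l r : screening i j b (var (l, r)) =
    coroot K i j b l *: exp_series (screening_exponent i j b) r.
  by rewrite /screening (pm_vf_var PM).
split=> // [l|P]; first by rewrite Vvar exp_series0.
apply/eqP; rewrite addrC -subr_eq; apply/eqP; move: P.
apply: (eq_derivation PM (derivation_comm derV derT) (derivation_mul _ derV)).
move=> [l r]; rewrite T_var.
rewrite mulr_natl -scaler_nat (drvZ derV) !Vvar scalerA mulrC -scalerA.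
rewrite (exp_series_rec (pm_char PM) derT); last first.
  move=> m; rewrite /screening_exponent /= (drvB derT) (drvZ derT) !T_var.
  by rewrite !mulr_natl -!scaler_nat scalerBr !scalerA mulrC.
rewrite (drvZ derT) scalerDr addrAC subrr add0r -scalerAr; congr (_ *: (_ * _)).
by rewrite /root_form /weight /screening_exponent expr0 scale1r.
Qed.

End Screening.

(** * Complete symmetric functions of noncommuting operators *)

Section CompleteSymmetric.

Variable A : zmodType.

(** [geometric x s] is the solution g of (1 - x z) g = s, for sequences
    identified with formal power series in z; thus [complete l s] applies the
    product of the series (1 - x z)^-1, for x in l, to s. *)
Fixpoint geometric (x : A -> A) (s : nat -> A) (m : nat) : A :=
  if m is m'.+1 then s m + x (geometric x s m') else s 0%N.

Definition complete (l : seq (A -> A)) (s : nat -> A) : nat -> A :=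
  foldr geometric s l.

Lemma complete_cat l l' s : complete (l ++ l') s = complete l (complete l' s).
Proof. exact: foldr_cat. Qed.

Lemma geometricD x s s' m : (forall P Q, x (P + Q) = x P + x Q) ->
  geometric x (fun k => s k + s' k) m = geometric x s m + geometric x s' m.
Proof. by move=> xD; elim: m => //= m ->; rewrite xD addrACA. Qed.

Lemma eq_geometric x s s' : s =1 s' -> geometric x s =1 geometric x s'.
Proof. by move=> ss'; elim=> [|m IHm] /=; rewrite ss' ?IHm. Qed.

Lemma completeD l s s' m :
  (forall x, List.In x l -> forall P Q, x (P + Q) = x P + x Q) ->
  complete l (fun k => s k + s' k) m = complete l s m + complete l s' m.
Proof.
elim: l m => //= x l IHl m lD.
rewrite (@eq_geometric x _ (fun k => complete l s k + complete l s' k)).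
  by apply: geometricD; apply: lD; left.
by move=> k; apply: IHl => y yl; apply: lD; right.
Qed.

End CompleteSymmetric.

(** * The generators are annihilated by the screening operators *)

Section ScreeningKernel.

Variables (K : fieldType) (n : nat) (A : comAlgType K).
Variables (var : 'I_n * nat -> A).
Variable T : A -> A.
Hypothesis derT : derivation T.

Local Notation node := ('I_n * bool)%type.
Local Notation weight := (weight var).

(** T + mu_i[-1] for the node (i, false), and T - mu_i[-1] for (i, true). *)
Definition node_op (a : node) (P : A) : A := T P + weight a * P.

Lemma node_opD a P Q : node_op a (P + Q) = node_op a P + node_op a Q.
Proof. by rewrite /node_op (drvD derT) mulrDr addrACA. Qed.

Lemma node_op0 a : node_op a 0 = 0.
Proof. by rewrite /node_op (drv0 derT) mulr0 addr0. Qed.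

Lemma node_opN a P : node_op a (- P) = - node_op a P.
Proof. by rewrite /node_op (drvN derT) mulrN opprD. Qed.

Definition completes (l : seq node) : (nat -> A) -> nat -> A :=
  complete (map node_op l).

Lemma completes_cat l l' s : completes (l ++ l') s = completes l (completes l' s).
Proof. by rewrite /completes map_cat complete_cat. Qed.

Lemma completesD l s s' m :
  completes l (fun k => s k + s' k) m = completes l s m + completes l s' m.
Proof.
apply: completeD => x; elim: l => //= a l IHl [<-|]; first exact: node_opD.
exact: IHl.
Qed.

Definition unit_seq (m : nat) : A := (m == 0%N)%:R.

(** E'_n is such a product, since mu_i[-1] - T is minus the operator of the node
    (i, true). *)
Definition neg_product (l : seq node) (P : A) : A :=
  foldr (fun a Q => - node_op a Q) P l.

Lemma neg_product_cat l l' P : neg_product (l ++ l') P =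
  neg_product l (neg_product l' P).
Proof. exact: foldr_cat. Qed.

Section OneScreening.

Variables (i j : 'I_n) (b : bool) (V : A -> A).
Hypothesis VP : root_operator var T i j b V.
Hypothesis ij : i != j.

Local Notation hwt := (coroot_wt K i j b).
Local Notation root := (root_form var i j b).

Let derV : derivation V. Proof. by case: VP. Qed.

Let V_node_op a P : V (node_op a P) =
  node_op a (V P) + root * V P + hwt a *: P.
Proof.
case: VP => _ Vvar VT; rewrite /node_op (drvD derV) VT (drvM derV).
by rewrite (V_weight derV Vvar) mulr_algl; ring.
Qed.

Definition screened (s : nat -> A) : Prop := forall m, V (s m) = 0.

Lemma screened_unit : screened unit_seq.
Proof.
by case=> [|m]; rewrite /unit_seq /= ?mulr1n ?mulr0n ?(drv1 derV) ?(drv0 derV).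
Qed.

Lemma screened_geometric a s : hwt a = 0 -> screened s ->
  screened (geometric (node_op a) s).
Proof.
move=> ha Vs; elim=> [|m IHm] /=; first exact: Vs.
by rewrite (drvD derV) Vs V_node_op IHm ha node_op0 mulr0 scale0r !addr0.
Qed.

Lemma screened_completes l s : all (fun a => hwt a == 0) l -> screened s ->
  screened (completes l s).
Proof.
move=> + Vs; elim: l => //= a l IHl /andP[/eqP ha hl].
exact: (screened_geometric ha (IHl hl)).
Qed.

(** The operator (1 - z x2) (1 - z x1) is invariant: the contributions of its
    factors to its variation cancel because x1 = x2 + root. *)
Lemma screened_pair a1 a2 s : hwt a1 = 1 -> hwt a2 = -1 ->
  weight a1 = weight a2 + root -> screened s ->
  screened (geometric (node_op a1) (geometric (node_op a2) s)).
Proof.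
move=> h1 h2 a12 Vs.
have x12 P : node_op a1 P = node_op a2 P + root * P.
  by rewrite /node_op a12 mulrDl addrA.
set c := geometric (node_op a2) s; set g := geometric (node_op a1) c.
have Vc m : V (c m.+1) = node_op a1 (V (c m)) - c m.
  by rewrite /c /= (drvD derV) Vs add0r V_node_op h2 scaleN1r x12.
suff main m : V (g m) = 0 /\ V (c m.+1) = - g m by move=> m; case: (main m).
elim: m => [|m [Vg Vcm]].
  by rewrite Vc /g /c /= Vs node_op0 sub0r.
split; last by rewrite Vc Vcm node_opN -opprD addrC.
rewrite /g /= (drvD derV) Vcm V_node_op Vg node_op0 mulr0 h1 scale1r.
by rewrite !add0r addNr.
Qed.

(** In the sum over the two orders of the middle operator y, y', the variation
    of the unpaired outer operator in one term cancels that of the unpaired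
    inner operator in the other term. *)
Lemma screened_triple x x' y y' s :
  hwt x = 1 -> hwt x' = -1 -> hwt y = -1 -> hwt y' = 1 ->
  weight x = weight y + root -> weight y' = weight x' + root -> screened s ->
  screened (fun m => completes [:: x; y; x'] s m + completes [:: x; y'; x'] s m).
Proof.
move=> hx hx' hy hy' xy y'x' Vs; rewrite /completes /complete /=.
set r := geometric (node_op x') s.
set q := geometric (node_op y') r; set p := geometric (node_op x) q.
set c := geometric (node_op y) r; set g := geometric (node_op x) c.
have xE P : node_op x P = node_op y P + root * P.
  by rewrite /node_op xy mulrDl addrA.
have y'E P : node_op y' P = node_op x' P + root * P.
  by rewrite /node_op y'x' mulrDl addrA.
have Vq : screened q := screened_pair hy' hx' y'x' Vs.
have Vr m : V (r m.+1) = - q m.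
  elim: m => [|m IHm]; rewrite [LHS]/= (drvD derV) Vs add0r V_node_op -y'E hx'.
    by rewrite /r /= Vs node_op0 add0r scaleN1r.
  by rewrite IHm node_opN scaleN1r -opprD addrC.
have cS m : c m.+1 = r m.+1 + node_op y (c m) by [].
have gS m : g m.+1 = c m.+1 + node_op x (g m) by [].
have pS m : p m.+1 = q m.+1 + node_op x (p m) by [].
have Vc m : V (c m.+1) = - p m - g m.
  elim: m => [|m IHm]; rewrite cS (drvD derV) Vr V_node_op -xE hy scaleN1r.
    have -> : V (c 0%N) = 0 by exact: Vs.
    by rewrite node_op0 add0r.
  by rewrite IHm node_opD !node_opN pS gS; ring.
elim=> [|m IHm].
  by rewrite (drvD derV) (_ : V (p 0%N) = 0) ?addr0 //; exact: Vq.
have Vgp : V (g m) = - V (p m).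
  by apply/eqP; rewrite -addr_eq0 -(drvD derV); apply/eqP.
rewrite (drvD derV) gS (drvD derV (c _)) pS (drvD derV (q _)) Vq Vc.
by rewrite !V_node_op hx !scale1r Vgp node_opN; ring.
Qed.

Lemma screened_neg_product l P : all (fun a => hwt a == 0) l -> V P = 0 ->
  V (neg_product l P) = 0.
Proof.
move=> + P0; elim: l => //= a l IHl /andP[/eqP ha hl].
by rewrite (drvN derV) V_node_op IHl // ha node_op0 mulr0 scale0r !addr0 oppr0.
Qed.

Lemma screened_neg_pair a1 a2 P : hwt a1 = -1 -> hwt a2 = 1 ->
  weight a2 = weight a1 + root -> V P = 0 -> V (neg_product [:: a1; a2] P) = 0.
Proof.
move=> h1 h2 a21 P0; rewrite /= (drvN derV) V_node_op (drvN derV) V_node_op.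
rewrite P0 h1 h2 node_op0 mulr0 !add0r !scale1r node_opN scaleN1r opprK.
by rewrite /node_op a21; ring.
Qed.

(** At the fork of the Dynkin diagram the two operators are the innermost ones, and
    the cancellation uses T 1 = 0. *)
Lemma screened_neg_pair1 a1 a2 : hwt a1 = -1 -> hwt a2 = -1 ->
  weight a1 + weight a2 + root = 0 -> V (neg_product [:: a1; a2] 1) = 0.
Proof.
move=> h1 h2 a12; rewrite /= (drvN derV) V_node_op (drvN derV) V_node_op.
rewrite (drv1 derV) h1 h2 node_op0 mulr0 !add0r !scaleN1r !opprK /node_op.
rewrite (drv1 derT) !mulr1 !add0r -[RHS]oppr0 -a12; ring.
Qed.

End OneScreening.

End ScreeningKernel.

(** * The generators as products along paths of nodes *)

Section ConsecutiveOrdinals.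

Variable n : nat.

Lemma consecutive_split (s : seq 'I_n) m (i j : 'I_n) :
  map val s = iota 0 m -> j = i.+1 :> nat -> (j < m)%N ->
  exists s1 s2, s = s1 ++ i :: j :: s2 /\
    all (fun x => (x != i) && (x != j)) (s1 ++ s2).
Proof.
move=> sE ji jm; exists (take i s), (drop i.+2 s); split.
  apply: (inj_map val_inj); rewrite map_cat /= map_take map_drop sE.
  rewrite -[LHS](cat_take_drop i); congr (_ ++ _).
  by rewrite -ji !drop_iota !add0n (_ : m - i = (m - i.+2).+2)%N //=; [rewrite -ji|lia].
have vals x : x \in take i s ++ drop i.+2 s -> (x < i)%N || (i.+2 <= x)%N.
  move=> xs; have : val x \in map val (take i s ++ drop i.+2 s) by exact: map_f.
  rewrite map_cat map_take map_drop sE mem_cat drop_iota take_iota !mem_iota.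
  rewrite /=; lia.
apply/allP => x /vals; rewrite -!val_eqE /= ji; lia.
Qed.

Lemma consecutive_rcons (s : seq 'I_n) (i : 'I_n) :
  map val s = iota 0 i.+1 -> exists2 s1, s = rcons s1 i & all (fun x : 'I_n => (x < i)%N) s1.
Proof.
move=> sE; exists (take i s).
  apply: (inj_map val_inj); rewrite map_rcons map_take sE -cats1 take_iota.
  by rewrite (minn_idPl (leqnSn i)) -[i.+1]addn1 iotaD.
apply/allP => x xs; have : val x \in map val (take i s) by exact: map_f.
by rewrite map_take sE take_iota mem_iota /=; lia.
Qed.

End ConsecutiveOrdinals.

Section Generators.

Variables (K : fieldType) (n : nat) (A : comAlgType K).
Variables (var : 'I_n * nat -> A) (dvar : 'I_n * nat -> A -> A).
Variables (ev : ('I_n * nat -> A) -> A -> A).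
Variables (vf : ('I_n * nat -> A) -> A -> A) (deg : A -> nat).
Hypothesis PM : polynomial_model var dvar ev vf deg.

Variable T : A -> A.
Hypothesis derT : derivation T.
Hypothesis T_var : forall i r, T (var (i, r)) = r.+1%:R * var (i, r.+1).

Variables (last : 'I_n) (ids : seq 'I_n).
Hypothesis lastE : last.+1 = n.
Hypothesis idsE : map val ids = iota 0 n.-1.

Local Notation node := ('I_n * bool)%type.
Local Notation top := (n.-1).*2.
Local Notation weight := (weight var).
Local Notation completes := (completes var T).
Local Notation unit_seq := (unit_seq A).

(** The nodes in the order of their depths, with only one of the two nodes of
    the middle depth. *)
Definition node_path (y : node) : seq node :=
  [seq (x, false) | x <- ids] ++ y :: [seq (x, true) | x <- rev ids].

Definition neg_path : seq node := [seq (x, true) | x <- rcons ids last].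

Let rconsE : map val (rcons ids last) = iota 0 n.
Proof.
rewrite map_rcons idsE -cats1 -[in RHS]lastE -[last.+1]addn1 iotaD add0n.
by rewrite (_ : n.-1 = last) //; have := lastE; lia.
Qed.

Section Screened.

Variables (i j : 'I_n) (b : bool) (V : A -> A).
Hypothesis ijb : simple_root i j b.
Hypothesis VP : root_operator var T i j b V.

Let depth_j : depth (j, b) = i.+1. Proof. by case: ijb. Qed.
Let i_lt : (i.+1 < n)%N. Proof. by case: ijb. Qed.
Let ij : i != j := simple_neq depth_j i_lt.
Local Notation hwt := (coroot_wt K i j b).

Let hwt_off (x : 'I_n) s : x != i -> x != j -> hwt (x, s) = 0.
Proof.
move=> xi xj; rewrite /coroot_wt /coroot /wt /= !(eq_sym _ x).
by rewrite (negPf xi) (negPf xj) !mulr0n subrr mulr0.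
Qed.

Let hwt_i s : hwt (i, s) = (-1) ^+ s.
Proof.
rewrite (coroot_wt_cases K depth_j i_lt) !xpair_eqE (negPf ij) eqxx /=.
by case: s => /=; ring.
Qed.

Let hwt_j s : hwt (j, s) = - (-1) ^+ (s (+) b).
Proof.
rewrite (coroot_wt_cases K depth_j i_lt) !xpair_eqE [j == i]eq_sym (negPf ij) eqxx /=.
by case: (s); case: (b) => /=; ring.
Qed.

Let offs s (l : seq 'I_n) : all (fun x => (x != i) && (x != j)) l ->
  all (fun a => hwt a == 0) [seq (x, s) | x <- l].
Proof.
by move=> /allP h; apply/allP => a /mapP[x /h /andP[xi xj] ->]; rewrite hwt_off.
Qed.

Let weight_true x : weight (x, true) = - weight (x, false).
Proof. exact: (weight_dual var (x, false)). Qed.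

Let root := root_form var i j b.

Let weight_i : weight (i, false) = weight (j, b) + root.
Proof. by rewrite /root /root_form addrC subrK. Qed.

Let weight_j : weight (j, ~~ b) = weight (i, true) + root.
Proof.
by rewrite weight_true (weight_dual var (j, b)) /root /root_form addrA addNr add0r.
Qed.

Let middle (jl : j = last) : exists2 s1, ids = rcons s1 i &
  all (fun x => (x != i) && (x != j)) s1.
Proof.
have il : (i.+1 = n.-1)%N.
  by move: depth_j; rewrite jl /depth /=; have := lastE; case: (b) => /=; lia.
have [s1 e a] : exists2 s1, ids = rcons s1 i & all (fun x : 'I_n => (x < i)%N) s1.
  by apply: consecutive_rcons; rewrite il.
exists s1 => //; apply: sub_all a => x xi.
by rewrite -!val_eqE /= jl; have := lastE; lia.
Qed.

Let simple_cases : j = last \/ b = false /\ j = i.+1 :> nat /\ (j < n.-1)%N.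
Proof.
have [->|jl] := eqVneq j last; [by left|right].
have jl' : (j < n.-1)%N.
  by move: jl; rewrite -val_eqE /= => jl; have := ltn_ord j; have := lastE; lia.
by move: depth_j; rewrite /depth; case: (b) => /=; lia.
Qed.

Lemma screened_node_paths m :
  V (completes (node_path (last, false)) unit_seq m +
     completes (node_path (last, true)) unit_seq m) = 0.
Proof.
have derV : derivation V by case: VP.
have unit0 : screened V unit_seq := screened_unit VP.
case: simple_cases => [jl|[b0 [ji jn]]]; last first.
  have [s1 [s2 [idsS off]]] := consecutive_split idsE ji jn.
  have [off1 off2] : all (fun x => (x != i) && (x != j)) s1 /\
      all (fun x => (x != i) && (x != j)) s2.
    by apply/andP; rewrite -all_cat.
  have Vp y : y.1 = last -> screened V (completes (node_path y) unit_seq).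
    case: y => _ t /= ->.
    have -> : node_path (last, t) = [seq (x, false) | x <- s1] ++
        [:: (i, false); (j, false)] ++ ([seq (x, false) | x <- s2] ++ (last, t) ::
        [seq (x, true) | x <- rev s2]) ++ [:: (j, true); (i, true)] ++
        [seq (x, true) | x <- rev s1].
      rewrite /node_path idsS !rev_cat !rev_cons -!cats1 !map_cat /= -!catA /=.
      by [].
    rewrite !completes_cat.
    apply: (screened_completes derT VP); first exact: offs.
    apply: (screened_pair derT VP); rewrite ?hwt_i ?hwt_j ?b0 ?expr0 ?expr1 //.
      by rewrite weight_i /root b0.
    have rl : (last != i) && (last != j).
      by rewrite -!val_eqE /=; have := lastE; lia.
    rewrite -completes_cat; apply: (screened_completes derT VP).
      rewrite all_cat /= offs // offs ?all_rev // andbT.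
      by case/andP: rl => li lj; rewrite hwt_off /= ?eqxx.
    apply: (screened_pair derT VP); rewrite ?hwt_i ?hwt_j ?b0 ?expr0 ?expr1 ?opprK //.
      by have := weight_j; rewrite /root b0.
    by apply: (screened_completes derT VP) => //; rewrite offs ?all_rev.
  by rewrite (drvD derV) !Vp ?addr0.
have [s1 idsS off] := middle jl.
pose r := completes [seq (x, true) | x <- rev s1] unit_seq.
have Vr : screened V r.
  by apply: (screened_completes derT VP) => //; rewrite offs ?all_rev.
have pathE t : completes (node_path (last, t)) unit_seq =
    completes [seq (x, false) | x <- s1]
      (completes [:: (i, false); (j, t); (i, true)] r).
  rewrite -!completes_cat /node_path idsS rev_rcons map_rcons cat_rcons jl.
  by rewrite -catA.
suff Vb : V (completes (node_path (last, b)) unit_seq m +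
             completes (node_path (last, ~~ b)) unit_seq m) = 0.
  by case: (b) Vb => //=; rewrite addrC.
rewrite !pathE -(completesD var derT).
apply: (screened_completes derT VP); first exact: offs.
apply: (screened_triple derT VP) => //; rewrite ?hwt_i ?hwt_j ?addbb ?expr0 ?expr1 //.
by case: (b); rewrite /= expr1 opprK.
Qed.

Lemma screened_neg_path : V (neg_product var T neg_path 1) = 0.
Proof.
have derV : derivation V by case: VP.
case b1 : b; last first.
  have ji : j = i.+1 :> nat by move: depth_j; rewrite b1.
  have jn : (j < n)%N by [].
  have [s1 [s2 [idsS off]]] := consecutive_split rconsE ji jn.
  have [off1 off2] : all (fun x => (x != i) && (x != j)) s1 /\
      all (fun x => (x != i) && (x != j)) s2.
    by apply/andP; rewrite -all_cat.
  rewrite /neg_path idsS map_cat neg_product_cat.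
  apply: (screened_neg_product derT VP); first exact: offs.
  rewrite -[map _ (i :: _)]/([:: (i, true); (j, true)] ++ map _ s2) neg_product_cat.
  apply: (screened_neg_pair derT VP); rewrite ?hwt_i ?hwt_j ?b1 ?expr1 ?opprK //.
    by have := weight_j; rewrite /root b1.
  by apply: (screened_neg_product derT VP); rewrite ?offs ?(drv1 derV).
have jl : j = last.
  by case: simple_cases => // -[]; rewrite b1.
have [s1 idsS off] := middle jl.
rewrite /neg_path idsS -!cats1 !map_cat -catA neg_product_cat.
apply: (screened_neg_product derT VP); first exact: offs.
apply: (screened_neg_pair1 derT VP); rewrite ?hwt_i -?jl ?hwt_j ?b1 ?expr1 //.
by rewrite /root_form weight_true; ring.
Qed.

End Screened.

(** * Leading terms of the generators *)

Local Notation jet := (jet var T).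
Local Notation below := (below dvar).

Definition leads (s : nat) (P : A) (f : 'I_n -> K) : Prop :=
  below s (P - \sum_l f l *: jet l s).

Lemma eq_leads s P f g : leads s P f -> f =1 g -> leads s P g.
Proof. by move=> + fg; rewrite /leads; under eq_bigr do rewrite fg. Qed.

Lemma leadsD s P Q f g :
  leads s P f -> leads s Q g -> leads s (P + Q) (fun l => f l + g l).
Proof.
move=> Pf Qg; rewrite /leads; under eq_bigr do rewrite scalerDl.
by rewrite big_split opprD addrACA; exact: (belowD PM).
Qed.

Lemma leadsZ s P c f : leads s P f -> leads s (c *: P) (fun l => c * f l).
Proof.
move=> Pf; rewrite /leads; under eq_bigr do rewrite -scalerA.
by rewrite -scaler_sumr -scalerBr; exact: (belowZ PM).
Qed.

Lemma below_jet i r s : (r < s)%N -> below s (jet i r).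
Proof. by move=> rs; rewrite (jetE derT T_var); apply/(belowZ PM)/(below_var PM). Qed.

Lemma below_weight a s : below s.+1 (weight a).
Proof. by apply/(belowZ PM)/(below_var PM). Qed.

Lemma leads_below s P f : leads s P f -> below s.+1 P.
Proof.
move=> Pf; rewrite -(subrK (\sum_l f l *: jet l s) P).
apply: (belowD PM); first exact: (belowW (leqnSn s)).
by apply: (below_sum PM) => l; apply/(belowZ PM)/below_jet.
Qed.

Lemma leads_node_op a s P f : leads s P f -> leads s.+1 (node_op var T a P) f.
Proof.
move=> Pf; rewrite /leads /node_op addrAC.
apply: (belowD PM); last by apply: (belowM PM); [exact: below_weight|exact: leads_below Pf].
have -> : \sum_l f l *: jet l s.+1 = T (\sum_l f l *: jet l s).
  by rewrite (drv_sum derT); apply: eq_bigr => l _; rewrite (drvZ derT).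
by rewrite -(drvB derT); exact: (below_T PM derT T_var).
Qed.

Lemma weight_leads a : leads 0 (weight a) (wt K a).
Proof.
rewrite /leads (bigD1 a.1) //= big1 => [|l la]; last first.
  by rewrite /wt eq_sym (negPf la) mulr0n scale0r.
by rewrite /wt eqxx mulr1n addr0 subrr; exact: (below0 PM).
Qed.

Definition path_coef (l : seq node) (m : nat) (q : 'I_n) : K :=
  \sum_(p < size l) 'C(p + m, m)%:R * wt K (nth (last, false) l p) q.

(** Modulo lower jets, a product of m + 1 operators applied to 1 is the m-th jet
    of the weight of the innermost operator, so a node at position p contributes
    with the number of weakly increasing sequences of length m in [0, p]. *)
Lemma completes_leads l m :
  leads m (completes l unit_seq m.+1) (path_coef l m).
Proof.
elim: m l => [|m IHm]; elim=> [|a l IHl].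
- rewrite /leads /completes /= /unit_seq /= big1 => [|q _].
    by rewrite subrr; exact: (below0 PM).
  by rewrite /path_coef big_ord0 scale0r.
- apply: (@eq_leads _ _ (fun q => path_coef l 0 q + wt K a q)); last first.
    move=> q; rewrite /path_coef big_ord_recl /= bin0 mul1r addrC.
    by congr (_ + _); apply: eq_bigr => p _; rewrite !bin0.
  apply: (leadsD IHl).
  suff -> : node_op var T a (completes (a :: l) unit_seq 0) = weight a.
    exact: weight_leads.
  have -> : completes (a :: l) unit_seq 0 = 1.
    by elim: (a :: l) => // c s.
  by rewrite /node_op (drv1 derT) mulr1 add0r.
- rewrite /leads /completes /= /unit_seq /= big1 => [|q _].
    by rewrite subrr; exact: (below0 PM).
  by rewrite /path_coef big_ord0 scale0r.
apply: (@eq_leads _ _ (fun q => path_coef l m.+1 q + path_coef (a :: l) m q)); last first.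
  move=> q; rewrite /path_coef /= !big_ord_recl /= !add0n !binn addrCA; congr (_ + _).
  rewrite -big_split; apply: eq_bigr => p _ /=.
  rewrite -mulrDl -natrD; congr (_%:R * _).
  by rewrite /bump /= add1n [in RHS]addSn binS addSnnS.
by apply: (leadsD IHl); exact: (leads_node_op a (IHm (a :: l))).
Qed.

Let ids_uniq : uniq ids.
Proof. by rewrite -(map_inj_uniq val_inj) idsE iota_uniq. Qed.

Let mem_ids q : (q \in ids) = (q.+1 < n)%N.
Proof.
by rewrite -(mem_map val_inj) idsE mem_iota /=; have := lastE; lia.
Qed.

Let depth_path t : map (@depth n) (node_path (last, t)) = iota 0 (size (node_path (last, t))).
Proof.
have sz : size ids = n.-1 by rewrite -(size_map val) idsE size_iota.
rewrite /node_path size_cat /= !size_map size_rev sz iotaD map_cat.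
congr (_ ++ _); first by rewrite -idsE -map_comp.
rewrite /= add0n; congr (_ :: _).
  by rewrite /depth /=; case: t => /=; have := lastE; lia.
apply: (@eq_from_nth _ 0%N); first by rewrite !size_map size_rev sz size_iota.
move=> p; rewrite !size_map size_rev sz => pn.
rewrite nth_iota // -map_comp (nth_map last) ?size_rev ?sz //.
rewrite nth_rev ?sz // /depth /=.
rewrite -(nth_map last 0%N val) ?sz; last by lia.
by rewrite idsE nth_iota; lia.
Qed.

Let path_coefE t m q : path_coef (node_path (last, t)) m q =
  \sum_(a <- node_path (last, t)) 'C(depth a + m, m)%:R * wt K a q.
Proof.
rewrite (big_nth (last, false)) big_mkord; apply: eq_bigr => p _.
suff -> : depth (nth (last, false) (node_path (last, t)) p) = p by [].
by rewrite -(nth_map _ 0%N) // depth_path nth_iota.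
Qed.

Lemma half_path_coef (m : nat) (q : 'I_n) :
  2%:R^-1 * path_coef (node_path (last, true)) m q +
  2%:R^-1 * path_coef (node_path (last, false)) m q =
  'C(q + m, m)%:R - 'C(top - q + m, m)%:R.
Proof.
have n2 : 2%:R != 0 :> K := pm_char PM 1.
rewrite -mulrDr !path_coefE /node_path !big_cat !big_cons /= !big_map.
have revE (G : 'I_n -> K) : \sum_(x <- rev ids) G x = \sum_(x <- ids) G x.
  by apply: perm_big; rewrite perm_rev.
rewrite !revE.
set X := \sum_(x <- ids) _ * _; set Y := \sum_(x <- ids) _ * _.
have sum_ids (G : 'I_n -> K) s : \sum_(x <- ids) G x * wt K (x, s) q =
    if (q.+1 < n)%N then G q * (-1) ^+ s else 0.
  rewrite -mem_ids; case: ifP => qi.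
    rewrite (bigD1_seq q) //= /wt eqxx mulr1n big1 ?addr0 // => x /negPf xq.
    by rewrite /= xq mulr0n mulr0.
  rewrite big_seq big1 // => x xi; rewrite /wt /=; case: eqP => [xq|].
    by rewrite -xq xi in qi.
  by rewrite mulr0n mulr0.
have XE := sum_ids (fun x => 'C(depth (x, false) + m, m)%:R) false.
have YE := sum_ids (fun x => 'C(depth (x, true) + m, m)%:R) true.
rewrite -/X in XE; rewrite -/Y in YE.
have -> : depth (last, true) = depth (last, false).
  by rewrite /depth /=; have := lastE; lia.
rewrite XE YE /wt /depth /=; case: ifP => qn.
  have -> : (last == q) = false by rewrite -val_eqE /=; have := lastE; lia.
  rewrite mulr0n !mulr0 expr0 expr1; apply: (mulfI n2).
  rewrite mulrA mulfV // mul1r; ring.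
have -> : q = last by apply: ord_inj; have := ltn_ord q; have := lastE; lia.
rewrite (_ : (top - last)%N = last); last by have := lastE; lia.
rewrite eqxx !mulr1n expr0 expr1 subrr; ring.
Qed.

Lemma half_paths_leads (j : 'I_n) : (j.+1 < n)%N ->
  leads (exponent j)
    (2%:R^-1 *: completes (node_path (last, true)) unit_seq (j.+1).*2 +
     2%:R^-1 *: completes (node_path (last, false)) unit_seq (j.+1).*2)
    (lead_form K last j).
Proof.
move=> jn; rewrite /exponent jn doubleS.
have half t := leadsZ 2%:R^-1 (@completes_leads (node_path (last, t)) j.*2.+1).
apply: (eq_leads (leadsD (half true) (half false))).
by move=> q; rewrite half_path_coef /lead_form jn.
Qed.

Lemma neg_path_leads :
  leads n.-1 (neg_product var T neg_path 1) (lead_form K last last).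
Proof.
have n_ids : size ids = n.-1 by rewrite -(size_map val) idsE size_iota.
rewrite /neg_path map_rcons -cats1 neg_product_cat.
have base : leads 0 (neg_product var T [:: (last, true)] 1) (fun l => (l == last)%:R).
  rewrite /= /node_op (drv1 derT) add0r mulr1 (weight_dual var (last, false)) opprK.
  apply: (eq_leads (@weight_leads (last, false))) => l.
  by rewrite /wt expr0 /= eq_sym.
have {base} step (l : seq 'I_n) : leads (size l)
    (neg_product var T [seq (x, true) | x <- l] (neg_product var T [:: (last, true)] 1))
    (fun q => (-1) ^+ size l * (q == last)%:R).
  elim: l => [|x l IHl]; first by apply: (eq_leads base) => q; rewrite mul1r.
  rewrite /= -scaleN1r.
  apply: (eq_leads (leadsZ (-1) (leads_node_op (x, true) IHl))) => q.
  by rewrite exprS mulrA.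
rewrite -n_ids; apply: (eq_leads (step ids)) => q.
by rewrite /lead_form lastE ltnn n_ids mulr_natr.
Qed.

End Generators.

(** * Sums over weakly increasing tuples *)

Section SortedTuples.

Variable V : zmodType.

Definition tuple_product k (s : seq (V -> V)) (t : k.-tuple 'I_(size s)) (v : V) : V :=
  foldr (fun f w => f w) v [seq nth id s (val i) | i <- t].

Definition sorted_sum (m : nat) (s : seq (V -> V)) (v : V) : V :=
  \sum_(t : m.-tuple 'I_(size s) | sorted leq [seq val i | i <- t])
     tuple_product t v.

Lemma sorted_sum0 s v : sorted_sum 0 s v = v.
Proof.
rewrite /sorted_sum (big_pred1 [tuple]) // => t.
by rewrite (tuple0 t) /=; apply/esym/eqP.
Qed.

Lemma sorted_sum_nil m v : sorted_sum m.+1 [::] v = 0.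
Proof.
by rewrite /sorted_sum big1 // => t _; case: (thead t) => i; rewrite ltn0.
Qed.

(** Either x does not occur in a product of weakly increasing operators, or it is
    the outermost one. *)
Lemma sorted_sum_cons m x s v : (forall a b, x (a + b) = x a + x b) ->
  sorted_sum m.+1 (x :: s) v = sorted_sum m.+1 s v + x (sorted_sum m (x :: s) v).
Proof.
move=> xD; have x0 : x 0 = 0 by apply: (addrI (x 0)); rewrite -xD !addr0.
rewrite {1}/sorted_sum (bigID (fun t : m.+1.-tuple 'I_(size s).+1 => thead t == ord0)).
rewrite /= addrC; congr (_ + _).
  case: s => [|y s].
    rewrite sorted_sum_nil big1 // => t /andP[_].
    by case: (thead t) => [[]].
  pose up (t : m.+1.-tuple 'I_(size (y :: s))) := map_tuple (lift ord0) t.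
  pose down (t : m.+1.-tuple 'I_(size (y :: s)).+1) :=
    map_tuple (fun i : 'I_(size (y :: s)).+1 => @inord (size s) i.-1) t.
  have upK t : down (up t) = t.
    apply: eq_from_tnth => i; rewrite !tnth_map lift0 /=.
    by apply: val_inj; rewrite /= inordK.
  rewrite (reindex_onto up down) /=.
    apply: eq_big => [t|t _].
      rewrite upK eqxx andbT.
      have -> : thead (up t) != ord0 by rewrite /thead tnth_map eq_sym neq_lift.
      have -> : [seq val i | i <- up t] = map S [seq val i | i <- t].
        by rewrite -!map_comp; apply: eq_map => i; exact: (lift0 i).
      by rewrite andbT sorted_map.
    rewrite /tuple_product; congr (foldr _ _ _).
    rewrite [tval (up t)]/= -map_comp; apply: eq_map => i.
    exact: (congr1 (nth id [:: x, y & s]) (lift0 i)).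
  move=> t /andP[st t0]; apply: eq_from_tnth => i; rewrite !tnth_map.
  apply: ord_inj; rewrite lift0 /= inordK; last first.
    by have := ltn_ord (tnth t i); case: (tnth t i : nat).
  rewrite prednK //.
  have h0 : (0 < thead t)%N by rewrite lt0n -val_eqE in t0 *.
  apply: (leq_trans h0); move: st; rewrite -[thead t]/(tnth t ord0).
  case/tupleP: t {t0 h0} => j t /=; rewrite (path_sortedE leq_trans) => /andP[ja _].
  case: (unliftP ord0 i) => [k ->|->] //; rewrite tnthS tnth0.
  by move/allP: ja; apply; rewrite mem_map ?mem_tnth //; exact: val_inj.
pose up (t : m.-tuple 'I_(size s).+1) := [tuple of ord0 :: t].
pose down (t : m.+1.-tuple 'I_(size s).+1) := [tuple of behead t].
rewrite (reindex_onto up down) /=; last first.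
  move=> t /andP[_ /eqP t0]; apply: val_inj; rewrite /= -t0.
  by case/tupleP: t {t0} => i t; rewrite theadE.
rewrite /sorted_sum (big_morph x xD x0); apply: eq_big => [t|t _] //.
rewrite theadE eqxx andbT; have -> : down (up t) == t by apply/eqP/val_inj.
by rewrite andbT path_min_sorted //; apply/allP.
Qed.

End SortedTuples.

(** * The algebra pi_0 and its vector fields *)

Section ConcreteModel.

Variables (R : realType) (n : nat).

Local Notation C := R[i].
Local Notation pi0 := (polyalg C ('I_n * nat)%type).

Lemma charC (m : nat) : m.+1%:R != 0 :> C.
Proof. by rewrite pnatr_eq0. Qed.

Definition vfield (f : 'I_n * nat -> pi0) (P : pi0) : pi0 :=
  \sum_(i < n) \sum_(r < mu_bound P) f (i, val r) * dmu i r P.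

Lemma vfieldEw f N P : (mu_bound P <= N)%N ->
  vfield f P = \sum_(i < n) \sum_(r < N) f (i, val r) * dmu i r P.
Proof.
move=> leN; apply: eq_bigr => i _.
rewrite (big_ord_widen N (fun r => f (i, r) * dmu i r P)) //.
rewrite big_mkcond; apply: eq_bigr => r _; case: ltnP => // ?.
by rewrite dmu_ge ?mulr0.
Qed.

Lemma vfield_der f : derivation (vfield f).
Proof.
have scale_leib (B : comNzRingType) (a p q p' q' : B) :
  a * (p' * q + p * q') = a * p' * q + p * (a * q').
  by rewrite mulrDr !mulrA (mulrC p a).
split=> [P Q|P Q|c P].
- pose N := maxn (mu_bound (P + Q)) (maxn (mu_bound P) (mu_bound Q)).
  rewrite !(@vfieldEw f N) ?leq_max ?leqnn ?orbT // -big_split.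
  apply: eq_bigr => i _.
  by rewrite -big_split; apply: eq_bigr => r _; rewrite /dmu pderivD mulrDr.
- pose N := maxn (mu_bound (P * Q)) (maxn (mu_bound P) (mu_bound Q)).
  rewrite !(@vfieldEw f N) ?leq_max ?leqnn ?orbT // mulr_suml mulr_sumr -big_split.
  apply: eq_bigr => i _; rewrite mulr_suml mulr_sumr -big_split.
  apply: eq_bigr => r _; rewrite /dmu pderivM; exact: scale_leib.
- pose N := maxn (mu_bound (c *: P)) (mu_bound P).
  rewrite !(@vfieldEw f N) ?leq_max ?leqnn ?orbT // scaler_sumr.
  apply: eq_bigr => i _; rewrite scaler_sumr; apply: eq_bigr => r _.
  by rewrite /dmu (drvZ (derivation_pderiv C (i, val r))) scalerAr.
Qed.

Lemma vfield_var f x : vfield f (pvar C x) = f x.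
Proof.
case: x => i r.
have delta (B : nzRingType) (c : 'I_n -> nat -> B) N : (r < N)%N ->
    \sum_(j < n) \sum_(s < N) c j s * ((j, nat_of_ord s) == (i, r))%:R = c i r.
  move=> rN; rewrite (bigD1 i) //= (bigD1 (Ordinal rN)) //= eqxx mulr1.
  rewrite big1 => [|s]; last first.
    by rewrite xpair_eqE eqxx -val_eqE /= => /negPf->; rewrite mulr0.
  rewrite big1 ?addr0 // => j /negPf ne_j; rewrite big1 // => s _.
  by rewrite xpair_eqE ne_j mulr0.
rewrite (@vfieldEw f (maxn (mu_bound (pvar C (i, r))) r.+1)) ?leq_maxl //.
rewrite -(delta _ (fun j s => f (j, s)) (maxn (mu_bound (pvar C (i, r))) r.+1)).
  by apply: eq_bigr => j _; apply: eq_bigr => s _; rewrite /dmu pderiv_var.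
by rewrite leq_max leqnn orbT.
Qed.

Lemma derT_der : derivation (@derT R n).
Proof. exact: (vfield_der (fun x => x.2.+1%:R * mu R x.1 x.2.+1)). Qed.

Definition total_degree (P : pi0) : nat := \max_(m <- msupp P) (mdeg m).+1.

Lemma pi0_model : polynomial_model (@pvar C ('I_n * nat)%type)
  (@pderiv C ('I_n * nat)%type) (@peval C ('I_n * nat)%type pi0)
  vfield total_degree.
Proof.
have degP P d : (total_degree P <= d)%N <->
    forall m, m \in msupp P -> (mdeg m < d)%N.
  split=> [Pd m mP|Pd].
    apply: leq_trans Pd.
    exact: (leq_bigmax_seq (F := fun m : {cmonom _} => (mdeg m).+1) _ mP isT).
  by apply/bigmax_leqP_seq => m mP _; exact: Pd.
split.
- exact: charC.
- exact: (polyalg_ind charC).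
- exact: derivation_pderiv.
- exact: pderiv_var.
- exact: peval_alg.
- exact: pevalD.
- exact: pevalM.
- exact: peval_var.
- exact: (peval_closed charC).
- exact: (eq_peval charC).
- exact: vfield_der.
- exact: vfield_var.
- by move=> P dP; exists (P@_mone); exact: (pderiv_eq0_const charC dP).
- move=> P /eqP; rewrite -leqn0 => /degP P0.
  by rewrite (pmono_sum P) big_seq big1 // => m /P0.
- by move=> x P d /degP dP; apply/degP; exact: pderiv_lt_size dP.
Qed.

End ConcreteModel.

(** * The classical W-algebra *)

Lemma sum_coroot (K : fieldType) n (B : comAlgType K) (i j : 'I_n) b (E : B)
    (d : 'I_n -> B) : i != j ->
  \sum_l (coroot K i j b l *: E) * d l = E * (d i - (-1) ^+ b *: d j).
Proof.
move=> ij; have off l : l != i -> l != j -> coroot K i j b l = 0.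
  move=> li lj; rewrite /coroot /wt /= !(eq_sym _ l) (negPf li) (negPf lj).
  by rewrite !mulr0n subrr.
rewrite (bigD1 i) //= (bigD1 j) 1?eq_sym //= big1 ?addr0; last first.
  by move=> l /andP[li lj]; rewrite off // scale0r mul0r.
rewrite /coroot /wt /= !eqxx (negPf ij) eq_sym (negPf ij) !mulr0n !mulr1n expr0.
rewrite subr0 sub0r scale1r mulrBr; congr (_ + _).
by rewrite scaleNr mulNr -scalerAl -scalerAr.
Qed.

Lemma sub_sign0 (K : fieldType) (U : lmodType K) (x y : U) :
  x - y = x - (-1) ^+ false *: y.
Proof. by rewrite expr0 scale1r. Qed.

Lemma add_sign1 (K : fieldType) (U : lmodType K) (x y : U) :
  x + y = x - (-1) ^+ true *: y.
Proof. by rewrite expr1 scaleN1r opprK. Qed.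

Section Assembly.

Variables (R : realType) (n : nat).

Local Notation C := R[i].
Local Notation pi0 := (polyalg C ('I_n * nat)%type).
Local Notation var := (@pvar C ('I_n * nat)%type).
Local Notation T := (@derT R n).
Local Notation PM := (pi0_model R n).
Local Notation derT := (derT_der R n).
Local Notation T_var := (@derT_mu R n).
Local Notation screening := (screening var (@vfield R n)).

Lemma screeningE i j b P : i != j -> screening i j b P =
  \sum_(r < mu_bound P) exp_series (screening_exponent var i j b) r *
    (dmu i r P - (-1) ^+ b *: dmu j r P).
Proof.
move=> ij; rewrite /screening /vfield /= exchange_big /=; apply: eq_bigr => r _.
exact: (sum_coroot b _ (fun l => dmu l r P) ij).
Qed.

Lemma screening_subE (i j : 'I_n) P : i != j ->
  screening_sub i j P = screening i j false P.
Proof.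
move=> ij; rewrite (screeningE false P ij); apply: eq_bigr => r _.
apply: (f_equal2 *%R); last exact: sub_sign0.
by apply: eq_exp_series => m; exact: sub_sign0.
Qed.

Lemma screening_addE (i j : 'I_n) P : i != j ->
  screening_add i j P = screening i j true P.
Proof.
move=> ij; rewrite (screeningE true P ij); apply: eq_bigr => r _.
apply: (f_equal2 *%R); last exact: add_sign1.
by apply: eq_exp_series => m; exact: add_sign1.
Qed.

Lemma classical_WP (P : pi0) : classical_W P <->
  forall i j b, simple_root i j b -> screening i j b P = 0.
Proof.
split=> [[Wsub Wadd] i j b ijb|scr].
  have [dj ni] := ijb; have ij := simple_neq dj ni.
  case: b dj {ijb} => dj; last by rewrite -screening_subE // Wsub.
  rewrite -screening_addE // Wadd //; move: dj; rewrite /depth /=;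
    by have := ltn_ord i; have := ltn_ord j; lia.
split=> i j.
  move=> ji; rewrite screening_subE; last by rewrite -val_eqE /= ji; lia.
  by apply: scr; split; [rewrite /depth /= ji|rewrite -ji; exact: ltn_ord].
move=> i_n j_n; rewrite screening_addE; last by rewrite -val_eqE /=; lia.
by apply: scr; split; [rewrite /depth /=|]; lia.
Qed.

Lemma screeningP i j b : root_operator var T i j b (screening i j b).
Proof. exact: (screening_root_operator PM derT T_var). Qed.

Lemma classical_W_alg a : classical_W (a%:A : pi0).
Proof.
apply/classical_WP => i j b _.
by case: (screeningP i j b) => derV _ _; exact: (drv_alg derV).
Qed.

Lemma classical_WD (P Q : pi0) : classical_W P -> classical_W Q -> classical_W (P + Q).
Proof.
move=> /classical_WP WP /classical_WP WQ; apply/classical_WP => i j b ijb.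
by case: (screeningP i j b) => derV _ _; rewrite (drvD derV) WP ?WQ ?addr0.
Qed.

Lemma classical_WM (P Q : pi0) : classical_W P -> classical_W Q -> classical_W (P * Q).
Proof.
move=> /classical_WP WP /classical_WP WQ; apply/classical_WP => i j b ijb.
case: (screeningP i j b) => derV _ _.
by rewrite (drvM derV) WP ?WQ // mul0r mulr0 addr0.
Qed.

Lemma classical_W_T (P : pi0) : classical_W P -> classical_W (T P).
Proof.
move=> /classical_WP WP; apply/classical_WP => i j b ijb.
case: (screeningP i j b) => _ _ ->.
by rewrite WP // (drv0 derT) mulr0 addr0.
Qed.

Definition node_fun (a : 'I_n * bool) : pi0 -> pi0 :=
  if a.2 then @Tminus R n a.1 else @Tplus R n a.1.

Lemma node_funE a P : node_fun a P = node_op var T a P.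
Proof.
case: a => i []; rewrite /node_fun /node_op /weight /=.
  by rewrite /Tminus expr1 scaleN1r mulNr.
by rewrite /Tplus expr0 scale1r.
Qed.

Lemma hsym_completes m (l : seq ('I_n * bool)) :
  hsym m (map node_fun l) 1 = completes var T l (unit_seq pi0) m.
Proof.
rewrite -[LHS]/(sorted_sum m (map node_fun l) 1).
elim: l m => [|a l IHl]; elim=> [|m IHm].
- by rewrite sorted_sum0.
- by rewrite sorted_sum_nil.
- rewrite sorted_sum0; have := IHl 0%N; rewrite sorted_sum0 => ->.
  by [].
rewrite /= sorted_sum_cons => [|P Q]; last first.
  by rewrite !node_funE; exact: (node_opD var derT).
by rewrite IHl -[node_fun a :: _]/(map node_fun (a :: l)) IHm node_funE.
Qed.

Variable last : 'I_n.
Hypothesis lastE : last.+1 = n.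

Let iota_rcons : iota 0 n = rcons (iota 0 n.-1) n.-1.
Proof.
have := iotaD 0 n.-1 1; rewrite add0n cats1 => <-.
by rewrite (_ : (n.-1 + 1)%N = n) //; have := lastE; lia.
Qed.

Lemma val_idx' : map val (idx' n) = iota 0 n.-1.
Proof.
have -> : map val (idx' n) = [seq k <- iota 0 n | (k.+1 < n)%N].
  by rewrite /idx' /idx -val_enum_ord filter_map.
rewrite iota_rcons filter_rcons.
have -> : (n.-1.+1 < n)%N = false by have := lastE; lia.
by apply/all_filterP/allP => k; rewrite mem_iota; lia.
Qed.

Lemma idx_rcons : idx n = rcons (idx' n) last.
Proof.
apply: (inj_map val_inj); rewrite map_rcons val_idx' /idx val_enum_ord iota_rcons.
by congr rcons; rewrite /=; have := lastE; lia.
Qed.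

Lemma calFE m : calF R n m =
  (2%:R^-1 : C) *: completes var T (node_path (idx' n) (last, true)) (unit_seq pi0) m +
  (2%:R^-1 : C) *: completes var T (node_path (idx' n) (last, false)) (unit_seq pi0) m.
Proof.
have pathE t : map node_fun (node_path (idx' n) (last, t)) =
    map (@Tplus R n) (idx' n) ++ node_fun (last, t) ::
    map (@Tminus R n) (rev (idx' n)).
  by rewrite /node_path map_cat map_cons -!map_comp.
rewrite /calF -!hsym_completes !pathE idx_rcons rev_rcons map_rcons cat_rcons.
by [].
Qed.

Lemma calE'E : calE' R n = neg_product var T (neg_path last (idx' n)) 1.
Proof.
rewrite /calE' /op_prod /neg_product /neg_path -idx_rcons.
elim: (idx n) => //= i s ->.
rewrite /mu_minus /node_op (weight_dual _ (i, false)) /weight expr0 scale1r.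
by rewrite mulNr opprB.
Qed.

Definition generator (i : 'I_n) : pi0 :=
  if (i.+1 < n)%N then calF R n (i.+1).*2 else calE' R n.

Lemma generator_W j : classical_W (generator j).
Proof.
apply/classical_WP => i k b ikb; have VP := screeningP i k b.
have derV : derivation (screening i k b) by case: VP.
rewrite /generator; case: ifP => _.
  rewrite calFE -scalerDr (drvZ derV) addrC.
  by rewrite (screened_node_paths derT lastE val_idx' ikb VP) scaler0.
by rewrite calE'E (screened_neg_path derT lastE val_idx' ikb VP).
Qed.

Lemma generator_leads j : leads var (@pderiv C _) T (exponent j) (generator j)
  (lead_form C last j).
Proof.
rewrite /generator; case: ifP => jn.
  by rewrite calFE; exact: (half_paths_leads PM derT T_var lastE val_idx' jn).
have -> : j = last.
  by apply: ord_inj; have := ltn_ord j; have := lastE; lia.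
have -> : exponent last = n.-1 by rewrite /exponent lastE ltnn.
by rewrite calE'E; exact: (neg_path_leads PM derT T_var lastE val_idx').
Qed.

Let M : 'M[C]_n := \matrix_(j, l) lead_form C last j l.
Let c : 'M[C]_n := \matrix_(k, l) chain_direction C last k l.
Let Y := chain_derivation var (@vfield R n) T last.

Let B_lead j : below (@pderiv C _) (exponent j)
  (generator j - \sum_l M j l *: jet var T l (exponent j)).
Proof.
have -> : \sum_l M j l *: jet var T l (exponent j) =
    \sum_l lead_form C last j l *: jet var T l (exponent j).
  by apply: eq_bigr => l _; rewrite mxE.
exact: generator_leads.
Qed.

Let Y_W k s P : (s < exponent k)%N -> classical_W P -> Y k s P = 0.
Proof.
move=> _ /classical_WP WP; apply: chain_derivation_eq0 => // a d.
exact: (pair_der_eq0 PM derT T_var (fun i j b _ => screeningP i j b) WP).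
Qed.

Let Y_jet k s l : (s < exponent k)%N -> Y k s (jet var T l s) = (c k l)%:A.
Proof. by move=> sk; rewrite mxE; exact: (chain_derivation_jet PM derT T_var). Qed.

Let M_lt (j k : 'I_n) : (j < k)%N -> \sum_l M j l * c k l = 0.
Proof.
move=> jk; rewrite -[RHS](pairing_lt C lastE jk).
by apply: eq_bigr => l _; rewrite !mxE.
Qed.

Let M_diag (j : 'I_n) : \sum_l M j l * c j l != 0.
Proof.
have := pairing_diag PM lastE j; congr (_ != _).
by apply: eq_bigr => l _; rewrite !mxE.
Qed.

Lemma generators_complete : complete_generators generator.
Proof.
have derY := derivation_chain PM T last.
have Ylt := chain_derivation_jet_lt PM derT T_var lastE.
split; first exact: generator_W.
- exact: (generators_alg_independent PM derT T_var B_lead M_lt M_diag).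
- exact: (generators_generate PM derT T_var B_lead derY Y_W Ylt Y_jet M_lt M_diag
    classical_W_alg classical_WD classical_WM classical_W_T generator_W).
Qed.

End Assembly.

Theorem corollary5p4 (R : realType) (n : nat) (hn : (3 <= n)%N) :
  @complete_generators R n
    (fun i : 'I_n => if (i.+1 < n)%N then calF R n (i.+1).*2 else calE' R n).
Proof.
have lastP : (n.-1 < n)%N by rewrite ltn_predL; apply: leq_trans hn.
by apply: (@generators_complete R n (Ordinal lastP)); rewrite /= prednK // (leq_trans _ hn).
Qed.
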